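(* Let $\Omega \subseteq \mathbb{C}$ be an open set and $F \subseteq \mathbb{N}_0$ be a non-empty set. Then the space $H_{F}^{\infty}(\Omega)$ with its natural topology is a complete metric space.
   Context: $\mathbb{N}_0=\{0,1,2,\dots\}$. For an open set $\Omega\subseteq\mathbb{C}$, $H(\Omega)$ is the set of holomorphic functions on $\Omega$. For non-empty $F\subseteq\mathbb{N}_0$, $H_F^\infty(\Omega)=\{f\in H(\Omega): f^{(l)} \text{ is bounded on } \Omega \text{ for all } l\in F\}$. Let $\Omega_i$, $i\in I$ ($I$ finite or $I=\mathbb{N}$), be the connected components of $\Omega$ and fix a point $z_i\in\Omega_i$ for each $i\in I$. The natural topology of $H_F^\infty(\Omega)$ is the one induced by the countable family of seminorms $\sup_{z\in\Omega}|f^{(l)}(z)|$, $l\in F$, and $|f^{(l)}(z_i)|$, $0\leqslant l<\min F$, $i\in I$. The metric meant is the usual translation-invariant metric associated with this countable family of seminorms, so the assertion is that $H_F^\infty(\Omega)$ is a Fréchet space. *)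

(* Defs.v *)
From Stdlib Require Import Reals List Cantor ClassicalEpsilon Lia.
From Coquelicot Require Import Coquelicot.

Open Scope R_scope.

Definition open_C (U : C -> Prop) : Prop := open (T := C_UniformSpace) U.

Definition connected (S : C -> Prop) : Prop :=
  forall U V : C -> Prop,
    open_C U -> open_C V ->
    (forall z, S z -> U z \/ V z) ->
    (exists z, S z /\ U z) -> (exists z, S z /\ V z) ->
    exists z, S z /\ U z /\ V z.

Definition is_component (Om A : C -> Prop) : Prop :=
  (exists z, A z) /\ (forall z, A z -> Om z) /\ connected A /\
  forall B : C -> Prop,
    connected B -> (forall z, A z -> B z) -> (forall z, B z -> Om z) ->
    forall z, B z -> A z.

(** The index set is a subset of [nat], so it is finite iff it is bounded. *)
Definition finite_or_nat (I : nat -> Prop) : Prop :=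
  (exists N : nat, forall i, I i -> (i < N)%nat) \/ (forall i, I i).

Definition enumerates_components
    (Om : C -> Prop) (I : nat -> Prop) (Omi : nat -> C -> Prop) : Prop :=
  (forall i, I i -> is_component Om (Omi i)) /\
  (forall i j, I i -> I j -> (forall z, Omi i z <-> Omi j z) -> i = j) /\
  (forall A, is_component Om A -> exists i, I i /\ forall z, A z <-> Omi i z).

(** [C_derive] is total (a junk value is returned where the limit does not
    exist); for [f] holomorphic on an open set, [C_deriv_n f l] is the [l]-th
    complex derivative there. *)
Definition C_deriv_n (f : C -> C) (l : nat) : C -> C := Nat.iter l C_derive f.

Definition holomorphic_on (Om : C -> Prop) (f : C -> C) : Prop :=
  forall z, Om z -> ex_derive (K := C_AbsRing) (V := C_NormedModule) f z.

Definition bounded_on (Om : C -> Prop) (f : C -> C) : Prop :=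
  exists M : R, forall z, Om z -> Cmod (f z) <= M.

(** A function on [Om] is represented by its extension by [0] to the whole
    plane, so that two elements of the space are equal iff they agree on [Om].
    As [Om] is open, the extension does not affect derivatives on [Om]. *)
Definition H_F_infty (Om : C -> Prop) (F : nat -> Prop) (f : C -> C) : Prop :=
  (forall z, ~ Om z -> f z = 0%C) /\
  holomorphic_on Om f /\
  (forall l, F l -> bounded_on Om (C_deriv_n f l)).

Definition fadd (f g : C -> C) : C -> C := fun z => (f z + g z)%C.
Definition fsub (f g : C -> C) : C -> C := fun z => (f z - g z)%C.
Definition fscal (c : C) (f : C -> C) : C -> C := fun z => (c * f z)%C.

(** On the empty set this is [real m_infty = 0]. *)
Definition sup_norm (Om : C -> Prop) (f : C -> C) : R :=
  real (Lub_Rbar (fun x => exists z, Om z /\ x = Cmod (f z))).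

Inductive seminorm_index : Set :=
| SupDeriv (l : nat)
| PointDeriv (l i : nat).

Definition is_minimum (F : nat -> Prop) (m : nat) : Prop :=
  F m /\ forall l, F l -> (m <= l)%nat.

Definition valid_index (F I : nat -> Prop) (j : seminorm_index) : Prop :=
  match j with
  | SupDeriv l => F l
  | PointDeriv l i => (exists m, is_minimum F m /\ (l < m)%nat) /\ I i
  end.

Definition natural_seminorm
    (Om : C -> Prop) (z : nat -> C) (j : seminorm_index) (f : C -> C) : R :=
  match j with
  | SupDeriv l => sup_norm Om (C_deriv_n f l)
  | PointDeriv l i => Cmod (C_deriv_n f l (z i))
  end.

(** Repetitions are allowed, since the family of seminorms may be finite. *)
Definition enumerates_indices
    (J : seminorm_index -> Prop) (e : nat -> seminorm_index) : Prop :=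
  (forall k, J (e k)) /\ (forall j, J j -> exists k, e k = j).

Lemma enumerates_indices_ex (F I : nat -> Prop) :
  (exists l, F l) -> exists e, enumerates_indices (valid_index F I) e.
Proof.
intros [l0 Hl0].
set (dec := fun k : nat =>
  match Cantor.of_nat k with
  | (O, l) => SupDeriv l
  | (S i, l) => PointDeriv l i
  end).
exists (fun k => if excluded_middle_informative (valid_index F I (dec k))
                 then dec k else SupDeriv l0).
split.
- intros k. now destruct (excluded_middle_informative _).
- intros j Hj.
  assert (H : exists k, dec k = j).
  { destruct j as [l | l i].
    - exists (Cantor.to_nat (O, l)). unfold dec. now rewrite Cantor.cancel_of_to.
    - exists (Cantor.to_nat (S i, l)). unfold dec. now rewrite Cantor.cancel_of_to. }
  destruct H as [k Hk]. exists k. rewrite Hk.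
  now destruct (excluded_middle_informative _).
Qed.

Definition is_subspace (V : (C -> C) -> Prop) : Prop :=
  V (fun _ => 0%C) /\
  (forall f g, V f -> V g -> V (fadd f g)) /\
  (forall c f, V f -> V (fscal c f)).

Definition is_seminorm_on (V : (C -> C) -> Prop) (p : (C -> C) -> R) : Prop :=
  (forall f, V f -> 0 <= p f) /\
  (forall c f, V f -> p (fscal c f) = Cmod c * p f) /\
  (forall f g, V f -> V g -> p (fadd f g) <= p f + p g).

(** The topology on [V] induced by the seminorms [p j], [j] in [J]: finite
    intersections of seminorm balls around [f] form a neighbourhood basis of
    [f]. Only the trace of [U] on [V] matters. *)
Definition seminorm_open
    (V : (C -> C) -> Prop) (J : seminorm_index -> Prop)
    (p : seminorm_index -> (C -> C) -> R) (U : (C -> C) -> Prop) : Prop :=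
  forall f, V f -> U f ->
    exists (js : list seminorm_index) (eps : posreal),
      (forall j, In j js -> J j) /\
      forall g, V g -> (forall j, In j js -> p j (fsub g f) < eps) -> U g.

Definition metric_open
    (V : (C -> C) -> Prop) (d : (C -> C) -> (C -> C) -> R)
    (U : (C -> C) -> Prop) : Prop :=
  forall f, V f -> U f ->
    exists eps : posreal, forall g, V g -> d g f < eps -> U g.

Definition is_metric_on
    (V : (C -> C) -> Prop) (d : (C -> C) -> (C -> C) -> R) : Prop :=
  (forall f g, V f -> V g -> 0 <= d f g) /\
  (forall f g, V f -> V g -> (d f g = 0 <-> f = g)) /\
  (forall f g, V f -> V g -> d f g = d g f) /\
  (forall f g h, V f -> V g -> V h -> d f h <= d f g + d g h).

Definition translation_invariant_on
    (V : (C -> C) -> Prop) (d : (C -> C) -> (C -> C) -> R) : Prop :=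
  forall f g h, V f -> V g -> V h -> d (fadd f h) (fadd g h) = d f g.

Definition complete_on
    (V : (C -> C) -> Prop) (d : (C -> C) -> (C -> C) -> R) : Prop :=
  forall u : nat -> C -> C,
    (forall n, V (u n)) ->
    (forall eps : posreal, exists N : nat,
       forall n m, (N <= n)%nat -> (N <= m)%nat -> d (u n) (u m) < eps) ->
    exists f, V f /\
      forall eps : posreal, exists N : nat,
        forall n, (N <= n)%nat -> d (u n) f < eps.

Definition seminorms_dist (p : nat -> (C -> C) -> R) (f g : C -> C) : R :=
  Series (fun k => (/ 2) ^ k * (p k (fsub f g) / (1 + p k (fsub f g)))).

(* Main.v *)
(** A function that is merely complex differentiable on [|z - w| < r] and bounded
    by [M] there satisfies [|f' w| <= 2 M / r]: by Goursat's bisection argument,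
    in logarithmic polar coordinates, the mean over circles [|z| = r'] of
    [(f (w + z) - f w) / z] does not depend on [r'], and it tends to [f' w] as
    [r' -> 0]. This estimate makes the difference quotients of [f] converge
    locally uniformly together with their derivatives, so [f'] is again
    holomorphic, and it makes derivatives of locally uniformly convergent
    holomorphic sequences converge locally uniformly.

    Let [m = min F]. For a Cauchy sequence [u n] the [m]-th derivatives are
    uniformly Cauchy. If the [l + 1]-st derivatives are locally uniformly Cauchy
    then, by the mean value inequality, the set where the [l]-th derivatives are
    Cauchy is open and closed in each component, and it contains the base points;
    hence the [l]-th derivatives are locally uniformly Cauchy. Descending to
    [l = 0] gives a holomorphic limit, and all derivatives converge to those of
    the limit. *)

Require Import Defs.
From Stdlib Require Import Reals Lra Lia List ClassicalEpsilon FunctionalExtensionality.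
From Coquelicot Require Import Coquelicot.

Open Scope R_scope.

(** * Complex derivatives *)

Notation is_C_derive := (is_derive (K := C_AbsRing) (V := C_NormedModule)).

(** Neighbourhoods in [C_AbsRing] are balls for [Cmod], so both sides differ only by a rearrangement
    of the remainder. The estimates below start from this epsilon-delta form. *)
Lemma is_C_derive_iff (f : C -> C) (z l : C) :
  is_C_derive f z l <->
  forall eps : R, 0 < eps -> exists d : R, 0 < d /\
    forall w, Cmod (w - z) < d -> Cmod (f w - f z - l * (w - z)) <= eps * Cmod (w - z).
Proof.
split.
- intros [_ H] eps he.
  destruct (H z (fun P HP => HP) (mkposreal eps he)) as [d Hd].
  exists d; split; [apply d|].
  intros w hw.
  specialize (Hd w hw).
  unfold minus, plus, opp, scal, norm in Hd; simpl in Hd.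
  unfold minus, plus, opp, scal, norm, abs, mult in Hd; simpl in Hd.
  replace (f w - f z - l * (w - z))%C with (f w + - f z + - ((w + - z) * l))%C by ring.
  exact Hd.
- intros H. split.
  + apply is_linear_scal_l.
  + intros x Hx.
    apply (is_filter_lim_locally_unique (V := AbsRing_NormedModule C_AbsRing)) in Hx.
    subst x. intros eps. destruct (H eps (cond_pos eps)) as [d [d0 Hd]].
    exists (mkposreal d d0). intros w hw.
    specialize (Hd w hw).
    unfold minus, plus, opp, scal, norm; simpl.
    unfold minus, plus, opp, scal, norm, abs, mult; simpl.
    replace (f w + - f z + - ((w + - z) * l))%C with (f w - f z - l * (w - z))%C by ring.
    exact Hd.
Qed.

(** The balls of [C_UniformSpace] are squares, those of [C_AbsRing] round discs; [locally_C]
    identifies the two kinds of neighbourhoods. *)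
Lemma open_C_iff (U : C -> Prop) :
  open (T := C_UniformSpace) U <->
  forall z, U z -> exists r, 0 < r /\ forall w, Cmod (w - z) < r -> U w.
Proof.
split.
- intros H z hz. specialize (H z hz).
  apply locally_C in H. destruct H as [d Hd].
  exists d; split; [apply d|]. intros w hw; apply Hd, hw.
- intros H z hz. destruct (H z hz) as [r [r0 Hr]].
  apply locally_C. exists (mkposreal r r0). intros w hw; apply Hr, hw.
Qed.

(** * Inequalities for the complex modulus *)

Lemma Cmod_minus_sym (x y : C) : Cmod (x - y) = Cmod (y - x).
Proof. rewrite <- Cmod_opp. f_equal; ring. Qed.

Lemma Cmod_triangle_minus (x y z : C) : Cmod (x - z) <= Cmod (x - y) + Cmod (y - z).
Proof. replace (x - z)%C with ((x - y) + (y - z))%C by ring. apply Cmod_triangle. Qed.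

Lemma Cmod_minus_le (x y : C) : Cmod (x - y) <= Cmod x + Cmod y.
Proof. rewrite <- (Cmod_opp y). apply Cmod_triangle. Qed.

Lemma Cmod_minus_diag (x : C) : Cmod (x - x) = 0.
Proof. replace (x - x)%C with (RtoC 0) by ring. apply Cmod_0. Qed.

Lemma Cmod_minus_le_0 (x y : C) : Cmod (x - y) <= 0 -> x = y.
Proof.
intros h. assert (E : (x - y)%C = 0%C).
{ apply Cmod_eq_0. apply Rle_antisym; auto using Cmod_ge_0. }
replace x with (x - y + y)%C by ring. rewrite E. ring.
Qed.

Lemma im_le_Cmod (c : C) : Rabs (Im c) <= Cmod c.
Proof. apply Rle_trans with (2 := Rmax_Cmod c). apply Rmax_r. Qed.

Lemma Cmod_le_Re_Im (c : C) : Cmod c <= Rabs (Re c) + Rabs (Im c).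
Proof.
destruct c as [x y]. simpl.
replace (x, y) with (RtoC x + Ci * RtoC y)%C.
- apply Rle_trans with (1 := Cmod_triangle _ _).
  rewrite Cmod_mult, Cmod_Ci, !Cmod_R. lra.
- unfold Cplus, Cmult, Ci, RtoC; simpl. f_equal; ring.
Qed.

Lemma Cmod_RtoC_nonneg (x : R) : 0 <= x -> Cmod x = x.
Proof. intros. now rewrite Cmod_R, Rabs_pos_eq. Qed.

(** * Rules of complex differentiation *)

Lemma is_C_derive_plus (f g : C -> C) (z l1 l2 : C) :
  is_C_derive f z l1 -> is_C_derive g z l2 ->
  is_C_derive (fun x => f x + g x)%C z (l1 + l2)%C.
Proof. exact (is_derive_plus (K := C_AbsRing) (V := C_NormedModule) f g z l1 l2). Qed.

Lemma is_C_derive_minus (f g : C -> C) (z l1 l2 : C) :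
  is_C_derive f z l1 -> is_C_derive g z l2 ->
  is_C_derive (fun x => f x - g x)%C z (l1 - l2)%C.
Proof. exact (is_derive_minus (K := C_AbsRing) (V := C_NormedModule) f g z l1 l2). Qed.

Lemma is_C_derive_scal (c : C) (f : C -> C) (z l : C) :
  is_C_derive f z l -> is_C_derive (fun x => c * f x)%C z (c * l)%C.
Proof.
rewrite !is_C_derive_iff. intros H eps heps.
assert (hc := Cmod_ge_0 c).
destruct (H (eps / (Cmod c + 1))) as [d [d0 Hd]].
{ apply Rdiv_lt_0_compat; lra. }
exists d; split; auto. intros w hw. specialize (Hd w hw).
replace (c * f w - c * f z - c * l * (w - z))%C
  with (c * (f w - f z - l * (w - z)))%C by ring.
rewrite Cmod_mult.
apply Rle_trans with ((Cmod c + 1) * (eps / (Cmod c + 1) * Cmod (w - z))).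
- apply Rmult_le_compat; auto using Cmod_ge_0; lra.
- right; field; lra.
Qed.

Lemma is_C_derive_shift (f : C -> C) (h z l : C) :
  is_C_derive f (z + h)%C l -> is_C_derive (fun x => f (x + h)%C) z l.
Proof.
rewrite !is_C_derive_iff. intros H eps heps.
destruct (H eps heps) as [d [d0 Hd]].
exists d; split; auto. intros w hw.
specialize (Hd (w + h)%C).
replace (w + h - (z + h))%C with (w - z)%C in Hd by ring. auto.
Qed.

Lemma is_C_derive_linear (l z : C) : is_C_derive (fun x => l * x)%C z l.
Proof.
rewrite is_C_derive_iff. intros eps heps. exists 1; split; [lra|]. intros w _.
replace (l * w - l * z - l * (w - z))%C with (RtoC 0) by ring.
rewrite Cmod_0. apply Rmult_le_pos; [lra | apply Cmod_ge_0].
Qed.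

Lemma is_C_derive_const (c z : C) : is_C_derive (fun _ => c) z (RtoC 0).
Proof. exact (is_derive_const (K := C_AbsRing) (V := C_NormedModule) c z). Qed.

(** This case of the quotient rule serves the function [(f (w + z) - f w) / z] in Cauchy's
    estimate. *)
Lemma is_C_derive_div_id (h : C -> C) (z l : C) :
  z <> 0%C -> is_C_derive h z l ->
  is_C_derive (fun x => h x / x)%C z (l / z - h z / (z * z))%C.
Proof.
intros hz. rewrite !is_C_derive_iff. intros H eps heps.
assert (mz : 0 < Cmod z) by now apply Cmod_gt_0.
set (A := Cmod (z * l - h z)).
assert (hA : 0 <= A) by apply Cmod_ge_0.
destruct (H (eps * Cmod z / 4)) as [d [d0 Hd]].
{ apply Rdiv_lt_0_compat; [apply Rmult_lt_0_compat; lra | lra]. }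
(* [d1] makes the quadratic part of the remainder at most half of the allowed error; [A + 1] keeps
   the denominator positive when [A = 0]. *)
set (d1 := eps * Cmod z ^ 3 / (4 * (A + 1))).
assert (hd1 : 0 < d1).
{ apply Rdiv_lt_0_compat; [apply Rmult_lt_0_compat; auto; now apply pow_lt | lra]. }
exists (Rmin d (Rmin d1 (Cmod z / 2))). split.
{ repeat apply Rmin_pos; auto; lra. }
intros x hx.
assert (hx1 : Cmod (x - z) < d) by (apply Rlt_le_trans with (1 := hx); apply Rmin_l).
assert (hx2 : Cmod (x - z) < d1).
{ apply Rlt_le_trans with (1 := hx).
  apply Rle_trans with (1 := Rmin_r _ _); apply Rmin_l. }
assert (hx3 : Cmod (x - z) < Cmod z / 2).
{ apply Rlt_le_trans with (1 := hx).
  apply Rle_trans with (1 := Rmin_r _ _); apply Rmin_r. }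
assert (mx : Cmod z / 2 <= Cmod x).
{ assert (T := Cmod_triangle (z - x) x). replace (z - x + x)%C with z in T by ring.
  rewrite Cmod_minus_sym in T. lra. }
assert (hx0 : x <> 0%C). { apply Cmod_gt_0; lra. }
specialize (Hd x hx1).
set (e := (h x - h z - l * (x - z))%C) in *.
(* The remainder is that of [h] divided by [x], plus a term quadratic in [x - z]; both are
   controlled by [|x| >= |z| / 2]. *)
replace (h x / x - h z / z - (l / z - h z / (z * z)) * (x - z))%C
  with (e / x - (z * l - h z) * (x - z) * (x - z) / (x * (z * z)))%C
  by (unfold e; field; auto).
apply Rle_trans with (1 := Cmod_minus_le _ _).
rewrite !Cmod_div, !Cmod_mult; auto.
2: { repeat apply Cmult_neq_0; auto. }
fold A. set (D := Cmod (x - z)) in *. set (m := Cmod z) in *. set (mx' := Cmod x) in *.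
assert (hD : 0 <= D) by apply Cmod_ge_0.
assert (I : / mx' <= 2 / m).
{ apply Rle_trans with (/ (m / 2)). apply Rinv_le_contravar; lra. right; field; lra. }
assert (I0 : 0 < / mx') by (apply Rinv_0_lt_compat; lra).
assert (T1 : Cmod e / mx' <= eps / 2 * D).
{ apply Rle_trans with ((eps * m / 4 * D) * (2 / m)).
  - apply Rmult_le_compat; auto; [apply Cmod_ge_0 | lra].
  - right; field; lra. }
assert (T2 : A * D * D / (mx' * (m * m)) <= eps / 2 * D).
{ apply Rle_trans with ((A + 1) * D * d1 * (2 / (m * (m * m)))).
  - replace (A * D * D / (mx' * (m * m))) with ((A * D * D) * (/ mx' * / (m * m))) by (field; split; lra).
    replace (2 / (m * (m * m))) with (2 / m * / (m * m)) by (field; lra).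
    assert (0 <= / (m * m)). { left; apply Rinv_0_lt_compat, Rmult_lt_0_compat; lra. }
    apply Rmult_le_compat.
    + repeat apply Rmult_le_pos; auto.
    + apply Rmult_le_pos; lra.
    + repeat apply Rmult_le_compat; try apply Rmult_le_pos; lra.
    + apply Rmult_le_compat_r; auto.
  - right. unfold d1. field; split; lra. }
lra.
Qed.

(** Multiplication by [l] is the real linear map with rows [(Re l, - Im l)] and [(Im l, Re l)]:
    these are the Cauchy-Riemann equations. *)
Lemma is_C_derive_2d (g : C -> C) (x y : R) (l : C) :
  is_C_derive g (x, y) l ->
  differentiable_pt_lim (fun u v => Re (g (u, v))) x y (Re l) (- Im l) /\
  differentiable_pt_lim (fun u v => Im (g (u, v))) x y (Im l) (Re l).
Proof.
rewrite is_C_derive_iff. intros H.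
assert (K : forall eps : posreal, locally_2d (fun u v =>
    Cmod (g (u, v) - g (x, y) - l * ((u, v) - (x, y))) <=
    eps * Rmax (Rabs (u - x)) (Rabs (v - y))) x y).
{ intros eps.
  (* Real differentiability measures increments in the maximum norm, and the modulus is at most
     twice that norm. *)
  assert (E : forall u v, Cmod ((u, v) - (x, y)) <= 2 * Rmax (Rabs (u - x)) (Rabs (v - y))).
  { intros u v. apply Rle_trans with (1 := Cmod_le_Re_Im _). simpl.
    assert (A := Rmax_l (Rabs (u - x)) (Rabs (v - y))).
    assert (B := Rmax_r (Rabs (u - x)) (Rabs (v - y))).
    unfold Rminus in *. lra. }
  assert (he := cond_pos eps).
  destruct (H (eps / 2)) as [d [d0 Hd]]; [lra|].
  assert (d2 : 0 < d / 2) by lra.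
  exists (mkposreal _ d2). intros u v hu hv. simpl in hu, hv.
  specialize (E u v).
  apply Rle_trans with (eps / 2 * Cmod ((u, v) - (x, y))).
  - apply Hd. apply Rle_lt_trans with (1 := E).
    assert (Rmax (Rabs (u - x)) (Rabs (v - y)) < d / 2) by now apply Rmax_lub_lt. lra.
  - apply Rle_trans with (eps / 2 * (2 * Rmax (Rabs (u - x)) (Rabs (v - y)))).
    + apply Rmult_le_compat_l; lra.
    + right; field. }
split; intros eps; destruct (K eps) as [d Hd]; exists d; intros u v hu hv;
  specialize (Hd u v hu hv); apply Rle_trans with (2 := Hd).
- apply Rle_trans with (2 := re_le_Cmod _). right; f_equal. simpl. unfold Re, Im. ring.
- apply Rle_trans with (2 := im_le_Cmod _). right; f_equal. simpl. unfold Re, Im. ring.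
Qed.

(** With [k = f b - f a], the real mean value theorem for [Re (conj k * f)] along the segment gives
    [|k|^2 <= |k| * M * |b - a|]. *)
Lemma C_mean_value (f df : C -> C) (a b : C) (M : R) :
  (forall t : R, 0 <= t <= 1 ->
     is_C_derive f (a + t * (b - a))%C (df (a + t * (b - a))%C) /\
     Cmod (df (a + t * (b - a))%C) <= M) ->
  Cmod (f b - f a) <= M * Cmod (b - a).
Proof.
intros H.
set (k := (f b - f a)%C).
destruct (Req_dec (Cmod k) 0) as [k0 | k0].
{ rewrite k0. apply Rmult_le_pos; [|apply Cmod_ge_0].
  apply Rle_trans with (2 := proj2 (H 0 ltac:(lra))). apply Cmod_ge_0. }
assert (hk := Cmod_ge_0 k).
set (g := fun z => (Cconj k * f z)%C).
set (phi := fun t : R => Re (g (Re a + t * (Re b - Re a), Im a + t * (Im b - Im a)))).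
assert (P : forall t : R, (Re a + t * (Re b - Re a), Im a + t * (Im b - Im a)) = (a + t * (b - a))%C).
{ intros t. destruct a, b. unfold Cplus, Cmult, Cminus, Copp, RtoC; simpl. f_equal; ring. }
set (dphi := fun t : R => Re (Cconj k * df (a + t * (b - a)) * (b - a))%C).
assert (D : forall t, 0 <= t <= 1 -> is_derive phi t (dphi t)).
{ intros t ht. destruct (H t ht) as [Hd _]. rewrite <- P in Hd.
  apply (is_C_derive_scal (Cconj k)) in Hd.
  apply is_C_derive_2d in Hd. destruct Hd as [Hd _].
  rewrite P in Hd.
  replace (dphi t) with
    (Re (Cconj k * df (a + t * (b - a)))%C * (Re b - Re a) +
     - Im (Cconj k * df (a + t * (b - a)))%C * (Im b - Im a)).
  - apply is_derive_Reals.
    apply (derivable_pt_lim_comp_2d (fun u v => Re (g (u, v)))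
             (fun t => Re a + t * (Re b - Re a)) (fun t => Im a + t * (Im b - Im a))).
    + exact Hd.
    + apply is_derive_Reals. auto_derive; auto; ring.
    + apply is_derive_Reals. auto_derive; auto; ring.
  - unfold dphi. set (q := (Cconj k * df (a + t * (b - a)))%C).
    destruct q, a, b; simpl; ring. }
destruct (MVT_gen phi 0 1 dphi) as [c [hc E]].
- intros x hx. apply D. rewrite Rmin_left, Rmax_right in hx by lra. lra.
- intros x hx. rewrite Rmin_left, Rmax_right in hx by lra.
  apply continuity_pt_filterlim. apply (ex_derive_continuous (V := R_NormedModule)).
  exists (dphi x). now apply D.
- rewrite Rmin_left, Rmax_right in hc by lra.
  destruct (H c hc) as [_ HM].
  assert (E2 : Cmod k ^ 2 = phi 1 - phi 0).
  { unfold phi. rewrite !P.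
    replace (a + 1%R * (b - a))%C with b by ring.
    replace (a + 0%R * (b - a))%C with a by ring.
    rewrite Cmod2_alt. unfold g. unfold k. destruct (f a), (f b); simpl; ring. }
  rewrite E in E2.
  assert (L : Cmod k ^ 2 <= Cmod k * (M * Cmod (b - a))).
  { rewrite E2. rewrite Rminus_0_r, Rmult_1_r.
    apply Rle_trans with (1 := Rle_abs _).
    apply Rle_trans with (1 := re_le_Cmod _).
    rewrite !Cmod_mult, Cmod_conj, Rmult_assoc.
    apply Rmult_le_compat_l; auto.
    apply Rmult_le_compat_r; auto using Cmod_ge_0. }
  apply (Rmult_le_reg_l (Cmod k)); [lra|]. simpl in L. lra.
Qed.

(** * Goursat's theorem on rectangles *)

(** The integral of the form [P dx + Q dy] counterclockwise around the rectangle [[a, b] x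
    [c, d]]. *)
Definition boundary_integral (P Q : R -> R -> R) (a b c d : R) : R :=
  RInt (fun x => P x c - P x d) a b + RInt (fun y => Q b y - Q a y) c d.

(** The shared [k] is both the [y]-derivative of [P] and the [x]-derivative of [Q].
    Differentiability is asked pointwise, without continuity of the partial derivatives. *)
Definition closed_on_rectangle (P Q : R -> R -> R) (a b c d : R) : Prop :=
  forall x y, a <= x <= b -> c <= y <= d ->
    exists px k qy,
      differentiable_pt_lim P x y px k /\ differentiable_pt_lim Q x y k qy.

Lemma differentiable_pt_lim_continuous_fst P x y lx ly :
  differentiable_pt_lim P x y lx ly -> continuous (fun t => P t y) x.
Proof.
intros H. apply (ex_derive_continuous (V := R_NormedModule)).
exists (lx * 1 + ly * 0). apply is_derive_Reals.
apply (derivable_pt_lim_comp_2d P (fun t => t) (fun _ => y)).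
- exact H.
- apply derivable_pt_lim_id.
- apply derivable_pt_lim_const.
Qed.

Lemma differentiable_pt_lim_continuous_snd P x y lx ly :
  differentiable_pt_lim P x y lx ly -> continuous (fun t => P x t) y.
Proof.
intros H. apply (ex_derive_continuous (V := R_NormedModule)).
exists (lx * 0 + ly * 1). apply is_derive_Reals.
apply (derivable_pt_lim_comp_2d P (fun _ => x) (fun t => t)).
- exact H.
- apply derivable_pt_lim_const.
- apply derivable_pt_lim_id.
Qed.

Lemma closed_on_rectangle_sub P Q a b c d a' b' c' d' :
  closed_on_rectangle P Q a b c d ->
  a <= a' -> b' <= b -> c <= c' -> d' <= d ->
  closed_on_rectangle P Q a' b' c' d'.
Proof. intros H ? ? ? ? x y ? ?. apply H; lra. Qed.

Lemma ex_RInt_horizontal P Q a b c d y1 y2 :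
  closed_on_rectangle P Q a b c d -> a <= b ->
  c <= y1 <= d -> c <= y2 <= d -> ex_RInt (fun x => P x y1 - P x y2) a b.
Proof.
intros H hab h1 h2. apply (ex_RInt_continuous (V := R_CompleteNormedModule)).
intros x hx. rewrite Rmin_left, Rmax_right in hx by lra.
apply (continuous_minus (V := R_NormedModule)).
- destruct (H x y1 hx h1) as [? [? [? [H1 _]]]].
  exact (differentiable_pt_lim_continuous_fst _ _ _ _ _ H1).
- destruct (H x y2 hx h2) as [? [? [? [H1 _]]]].
  exact (differentiable_pt_lim_continuous_fst _ _ _ _ _ H1).
Qed.

Lemma ex_RInt_vertical P Q a b c d x1 x2 :
  closed_on_rectangle P Q a b c d -> c <= d ->
  a <= x1 <= b -> a <= x2 <= b -> ex_RInt (fun y => Q x2 y - Q x1 y) c d.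
Proof.
intros H hab h1 h2. apply (ex_RInt_continuous (V := R_CompleteNormedModule)).
intros y hy. rewrite Rmin_left, Rmax_right in hy by lra.
apply (continuous_minus (V := R_NormedModule)).
- destruct (H x2 y h2 hy) as [? [? [? [_ H1]]]].
  exact (differentiable_pt_lim_continuous_snd _ _ _ _ _ H1).
- destruct (H x1 y h1 hy) as [? [? [? [_ H1]]]].
  exact (differentiable_pt_lim_continuous_snd _ _ _ _ _ H1).
Qed.

(** The common edge [x = m] is traversed in both directions, so its contributions cancel. *)
Lemma boundary_integral_split_fst P Q a m b c d :
  closed_on_rectangle P Q a b c d -> a <= m <= b -> c <= d ->
  boundary_integral P Q a b c d =
  boundary_integral P Q a m c d + boundary_integral P Q m b c d.
Proof.
intros H hm hcd. unfold boundary_integral.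
rewrite <- (RInt_Chasles (V := R_CompleteNormedModule) (fun x => P x c - P x d) a m b).
2,3: apply ex_RInt_horizontal with Q c d; try lra;
     apply (closed_on_rectangle_sub P Q a b c d); auto; lra.
rewrite (RInt_ext (fun y => Q b y - Q a y)
           (fun y => plus (Q m y - Q a y) (Q b y - Q m y))).
2: { intros; unfold plus; simpl; ring. }
rewrite (RInt_plus (V := R_CompleteNormedModule)).
2,3: apply (ex_RInt_vertical P Q a b c d); auto; lra.
unfold plus; simpl; ring.
Qed.

Lemma boundary_integral_split_snd P Q a b c m d :
  closed_on_rectangle P Q a b c d -> c <= m <= d -> a <= b ->
  boundary_integral P Q a b c d =
  boundary_integral P Q a b c m + boundary_integral P Q a b m d.
Proof.
intros H hm hcd. unfold boundary_integral.
rewrite <- (RInt_Chasles (V := R_CompleteNormedModule) (fun y => Q b y - Q a y) c m d).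
2,3: apply ex_RInt_vertical with P a b; try lra;
     apply (closed_on_rectangle_sub P Q a b c d); auto; lra.
rewrite (RInt_ext (fun x => P x c - P x d)
           (fun x => plus (P x c - P x m) (P x m - P x d))).
2: { intros; unfold plus; simpl; ring. }
rewrite (RInt_plus (V := R_CompleteNormedModule)).
2,3: apply (ex_RInt_horizontal P Q a b c d); auto; lra.
unfold plus; simpl; ring.
Qed.

Lemma RInt_near_const f a b k M :
  a <= b -> ex_RInt f a b ->
  (forall x, a <= x <= b -> Rabs (f x - k) <= M) ->
  Rabs (RInt f a b - (b - a) * k) <= (b - a) * M.
Proof.
intros hab hf H.
replace (RInt f a b - (b - a) * k) with (RInt (fun x => f x - k) a b).
- apply abs_RInt_le_const; auto.
  apply (ex_RInt_minus (V := R_NormedModule)); auto. apply ex_RInt_const.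
- transitivity (minus (RInt f a b) (RInt (fun _ => k) a b)).
  + apply (RInt_minus (V := R_CompleteNormedModule)); auto. apply ex_RInt_const.
  + rewrite RInt_const. unfold minus, plus, opp, scal; simpl.
    unfold mult; simpl; ring.
Qed.

(* The affine part of the form contributes [k * area - k * area], so only the
   first-order error terms are left. *)
Lemma boundary_integral_small P Q u v px k qy eps :
  0 < eps ->
  differentiable_pt_lim P u v px k -> differentiable_pt_lim Q u v k qy ->
  exists delta, 0 < delta /\
    forall a b c d, a <= u <= b -> c <= v <= d -> b - a < delta -> d - c < delta ->
      closed_on_rectangle P Q a b c d ->
      Rabs (boundary_integral P Q a b c d) <= eps * (b - a + (d - c)) ^ 2.
Proof.
intros heps HP HQ.
assert (he : 0 < eps / 2) by lra.
destruct (HP (mkposreal _ he)) as [d1 H1].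
destruct (HQ (mkposreal _ he)) as [d2 H2]. simpl in H1, H2.
exists (Rmin d1 d2). split. { apply Rmin_pos; [apply d1 | apply d2]. }
intros a b c d hu hv hab hcd Hcl.
assert (hd1 := Rmin_l d1 d2). assert (hd2 := Rmin_r d1 d2).
set (s := b - a + (d - c)).
assert (E : forall w, a <= u <= b -> forall x y, a <= x <= b -> c <= y <= d ->
   Rabs w <= eps / 2 * Rmax (Rabs (x - u)) (Rabs (y - v)) -> Rabs w <= eps / 2 * s).
{ intros w _ x y hx hy hw. apply Rle_trans with (1 := hw).
  apply Rmult_le_compat_l; [lra|].
  unfold s. apply Rmax_lub; apply Rabs_le; lra. }
assert (A : Rabs (RInt (fun x => P x c - P x d) a b - (b - a) * (k * (c - d))) <= (b - a) * (eps * s)).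
{ apply RInt_near_const; [lra| |].
  - apply ex_RInt_horizontal with Q c d; auto; lra.
  - intros x hx.
    assert (X1 := E _ hu x c hx ltac:(lra) (H1 x c ltac:(apply Rabs_def1; lra) ltac:(apply Rabs_def1; lra))).
    assert (X2 := E _ hu x d hx ltac:(lra) (H1 x d ltac:(apply Rabs_def1; lra) ltac:(apply Rabs_def1; lra))).
    apply Rabs_le_between in X1, X2. apply Rabs_le. lra. }
assert (B : Rabs (RInt (fun y => Q b y - Q a y) c d - (d - c) * (k * (b - a))) <= (d - c) * (eps * s)).
{ apply RInt_near_const; [lra| |].
  - apply ex_RInt_vertical with P a b; auto; lra.
  - intros y hy.
    assert (X1 := E _ hu a y ltac:(lra) hy (H2 a y ltac:(apply Rabs_def1; lra) ltac:(apply Rabs_def1; lra))).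
    assert (X2 := E _ hu b y ltac:(lra) hy (H2 b y ltac:(apply Rabs_def1; lra) ltac:(apply Rabs_def1; lra))).
    apply Rabs_le_between in X1, X2. apply Rabs_le. lra. }
unfold boundary_integral.
apply Rabs_le_between in A, B. apply Rabs_le.
replace (eps * s ^ 2) with ((b - a) * (eps * s) + (d - c) * (eps * s)) by (unfold s; ring).
lra.
Qed.

Lemma nested_intervals_point (a b : nat -> R) :
  (forall n, a n <= a (S n)) -> (forall n, b (S n) <= b n) ->
  (forall n, a n <= b n) -> exists u, forall n, a n <= u <= b n.
Proof.
intros Ha Hb Hab.
assert (Ma : forall n k, a n <= a (k + n)%nat).
{ intros n k; induction k; simpl; [lra|]. specialize (Ha (k + n)%nat); lra. }
assert (Mb : forall n k, b (k + n)%nat <= b n).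
{ intros n k; induction k; simpl; [lra|]. specialize (Hb (k + n)%nat); lra. }
assert (Hnm : forall n m, a n <= b m).
{ intros n m. specialize (Ma n m). specialize (Mb m n). specialize (Hab (m + n)%nat).
  rewrite (Nat.add_comm n m) in Mb. lra. }
destruct (completeness (fun x => exists n, x = a n)) as [u [Hu1 Hu2]].
- exists (b 0%nat). intros x [n ->]. apply Hnm.
- exists (a 0%nat), 0%nat. reflexivity.
- exists u. intros n. split.
  + apply Hu1. now exists n.
  + apply Hu2. intros x [m ->]. apply Hnm.
Qed.

(** If the integral were nonzero, repeated quartering would give nested rectangles whose integrals
    exceed [eps] times the square of the half-perimeter. At their common point
    [boundary_integral_small] contradicts this. *)
Lemma goursat_rectangle P Q a b c d :
  a <= b -> c <= d -> closed_on_rectangle P Q a b c d ->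
  boundary_integral P Q a b c d = 0.
Proof.
intros hab hcd Hcl.
destruct (Req_dec (b - a + (d - c)) 0) as [h0 | h0].
{ replace b with a by lra. replace d with c by lra.
  unfold boundary_integral. rewrite !RInt_point. unfold zero; simpl; ring. }
apply NNPP. intros Hne.
set (W := boundary_integral P Q) in *.
set (s := b - a + (d - c)) in *.
assert (hs : 0 < s) by (unfold s in *; lra).
(* The factor 2 makes the strict inequality in [bad] hold for the initial rectangle. *)
set (eps := Rabs (W a b c d) / (2 * s ^ 2)).
assert (hs2 : 0 < s ^ 2) by (apply pow_lt; lra).
assert (heps : 0 < eps).
{ apply Rdiv_lt_0_compat; [now apply Rabs_pos_lt | lra]. }
(* Halving both sides divides the bound by 4, so if all four quarters obeyed it, the whole rectangle
   would too. *)
set (bad := fun r : (R * R) * (R * R) =>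
  let '((x1, x2), (y1, y2)) := r in
  (a <= x1 /\ x1 <= x2 /\ x2 <= b /\ c <= y1 /\ y1 <= y2 /\ y2 <= d) /\
  eps * (x2 - x1 + (y2 - y1)) ^ 2 < Rabs (W x1 x2 y1 y2)).
set (half := fun r r' : (R * R) * (R * R) =>
  let '((x1, x2), (y1, y2)) := r in
  let '((x1', x2'), (y1', y2')) := r' in
  (x1 <= x1' /\ x2' <= x2 /\ y1 <= y1' /\ y2' <= y2) /\
  x2' - x1' = (x2 - x1) / 2 /\ y2' - y1' = (y2 - y1) / 2).
(* The implication stands under the existential, so that choice yields a step function defined on
   all rectangles. *)
assert (Hstep : forall r, exists r', bad r -> bad r' /\ half r r').
{ intros [[x1 x2] [y1 y2]].
  destruct (classic (bad ((x1, x2), (y1, y2)))) as [Hb | Hb].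
  2: { now exists ((x1, x2), (y1, y2)). }
  destruct Hb as [hin hW].
  set (xm := (x1 + x2) / 2). set (ym := (y1 + y2) / 2).
  assert (Hc : forall a' b' c' d', x1 <= a' -> b' <= x2 -> y1 <= c' -> d' <= y2 ->
     closed_on_rectangle P Q a' b' c' d').
  { intros. apply (closed_on_rectangle_sub P Q a b c d); auto; lra. }
  assert (HS : W x1 x2 y1 y2 = W x1 xm y1 ym + W x1 xm ym y2 + (W xm x2 y1 ym + W xm x2 ym y2)).
  { unfold W, xm, ym.
    rewrite (boundary_integral_split_fst P Q x1 ((x1 + x2) / 2) x2) by (try apply Hc; lra).
    rewrite (boundary_integral_split_snd P Q x1 ((x1 + x2) / 2) y1 ((y1 + y2) / 2) y2) by (try apply Hc; lra).
    rewrite (boundary_integral_split_snd P Q ((x1 + x2) / 2) x2 y1 ((y1 + y2) / 2) y2) by (try apply Hc; lra).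
    reflexivity. }
  assert (Hq : forall a' b' c' d', x1 <= a' -> b' <= x2 -> y1 <= c' -> d' <= y2 ->
    b' - a' = (x2 - x1) / 2 -> d' - c' = (y2 - y1) / 2 ->
    (exists r', bad ((x1, x2), (y1, y2)) -> bad r' /\ half ((x1, x2), (y1, y2)) r') \/
    Rabs (W a' b' c' d') <= eps * (x2 - x1 + (y2 - y1)) ^ 2 / 4).
  { intros a' b' c' d' ? ? ? ? e1 e2.
    destruct (Rle_lt_dec (Rabs (W a' b' c' d')) (eps * (x2 - x1 + (y2 - y1)) ^ 2 / 4)); [now right|left].
    exists ((a', b'), (c', d')). intros _. split; [split; [lra|] | split; lra].
    rewrite e1, e2. lra. }
  destruct (Hq x1 xm y1 ym) as [Hx | q1]; try (unfold xm, ym; lra); auto.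
  destruct (Hq x1 xm ym y2) as [Hx | q2]; try (unfold xm, ym; lra); auto.
  destruct (Hq xm x2 y1 ym) as [Hx | q3]; try (unfold xm, ym; lra); auto.
  destruct (Hq xm x2 ym y2) as [Hx | q4]; try (unfold xm, ym; lra); auto.
  exfalso.
  apply Rabs_le_between in q1, q2, q3, q4.
  apply Rlt_not_le in hW. apply hW. rewrite HS. apply Rabs_le. lra. }
destruct (choice _ Hstep) as [step Hst].
set (r := fun n => Nat.iter n step ((a, b), (c, d))).
assert (Hbad : forall n, bad (r n)).
{ induction n as [|n IH].
  - split; [lra|]. unfold eps. fold s.
    assert (0 < Rabs (W a b c d)) by now apply Rabs_pos_lt.
    replace (Rabs (W a b c d) / (2 * s ^ 2) * s ^ 2) with (Rabs (W a b c d) / 2) by (field; lra). lra.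
  - apply (Hst (r n) IH). }
assert (Hhalf : forall n, half (r n) (r (S n))).
{ intros n. apply (Hst (r n) (Hbad n)). }
assert (Hlen : forall n, let '((x1, x2), (y1, y2)) := r n in
   x2 - x1 = (b - a) * (/ 2) ^ n /\ y2 - y1 = (d - c) * (/ 2) ^ n).
{ induction n as [|n IH].
  - simpl. lra.
  - specialize (Hhalf n).
    destruct (r n) as [[x1 x2] [y1 y2]], (r (S n)) as [[x1' x2'] [y1' y2']].
    destruct Hhalf as [_ [e1 e2]]. rewrite e1, e2. destruct IH as [-> ->]. simpl. split; field. }
destruct (nested_intervals_point (fun n => fst (fst (r n))) (fun n => snd (fst (r n)))) as [u Hu].
1, 2: intros n; specialize (Hhalf n);
      destruct (r n) as [[x1 x2] [y1 y2]], (r (S n)) as [[x1' x2'] [y1' y2']];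
      simpl in *; lra.
{ intros n; specialize (Hbad n); destruct (r n) as [[x1 x2] [y1 y2]]; simpl in *; lra. }
destruct (nested_intervals_point (fun n => fst (snd (r n))) (fun n => snd (snd (r n)))) as [v Hv].
1, 2: intros n; specialize (Hhalf n);
      destruct (r n) as [[x1 x2] [y1 y2]], (r (S n)) as [[x1' x2'] [y1' y2']];
      simpl in *; lra.
{ intros n; specialize (Hbad n); destruct (r n) as [[x1 x2] [y1 y2]]; simpl in *; lra. }
destruct (Hcl u v (Hu 0%nat) (Hv 0%nat)) as [px [k [qy [HP HQ]]]].
destruct (boundary_integral_small P Q u v px k qy eps heps HP HQ) as [delta [hdelta Hsmall]].
(* After [n] halvings the half-perimeter [s / 2 ^ n] is below [delta]. *)
destruct (pow_lt_1_zero (/ 2) ltac:(rewrite Rabs_pos_eq; lra) (delta / s) ltac:(now apply Rdiv_lt_0_compat))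
  as [n Hn].
specialize (Hn n (Nat.le_refl n)). rewrite Rabs_pos_eq in Hn by (apply pow_le; lra).
apply (Rmult_lt_compat_r s _ _ hs) in Hn.
replace (delta / s * s) with delta in Hn by (field; lra).
specialize (Hbad n). specialize (Hlen n). specialize (Hu n). specialize (Hv n).
destruct (r n) as [[x1 x2] [y1 y2]]. simpl in Hu, Hv. destruct Hbad as [hin hW].
destruct Hlen as [e1 e2].
assert (hp : 0 <= (/ 2) ^ n) by (apply pow_le; lra).
apply Rlt_not_le in hW. apply hW. apply Hsmall; auto.
- rewrite e1. apply Rle_lt_trans with (2 := Hn). rewrite Rmult_comm.
  apply Rmult_le_compat_l; unfold s; lra.
- rewrite e2. apply Rle_lt_trans with (2 := Hn). rewrite Rmult_comm.
  apply Rmult_le_compat_l; unfold s; lra.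
- apply (closed_on_rectangle_sub P Q a b c d); auto; lra.
Qed.

(** * Cauchy's estimate *)

Lemma differentiable_pt_lim_mult x y : differentiable_pt_lim Rmult x y y x.
Proof.
intros eps. exists eps. intros u v hu hv.
replace (u * v - x * y - (y * (u - x) + x * (v - y))) with ((u - x) * (v - y)) by ring.
rewrite Rabs_mult.
apply Rmult_le_compat; auto using Rabs_pos; [lra | apply Rmax_r].
Qed.

Lemma differentiable_pt_lim_prod f g s t f' g' :
  is_derive f s f' -> is_derive g t g' ->
  differentiable_pt_lim (fun u v => f u * g v) s t (f' * g t) (f s * g').
Proof.
intros Hf Hg.
assert (H : differentiable_pt_lim (fun u v => f u * g v) s t
  (g t * f' + f s * 0) (g t * 0 + f s * g')).
{ apply (differentiable_pt_lim_comp Rmult (fun u _ => f u) (fun _ v => g v)).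
  - apply differentiable_pt_lim_mult.
  - apply differentiable_pt_lim_proj1_0. now apply is_derive_Reals.
  (* The second projection is obtained from the first by exchanging the two variables. *)
  - intros eps.
    assert (K : derivable_pt_lim g t g') by now apply is_derive_Reals.
    destruct (differentiable_pt_lim_proj1_0 g t s g' K eps) as [d Hd].
    exists d. intros u v hu hv. specialize (Hd v u hv hu).
    rewrite Rmax_comm.
    replace (g v - g t - (0 * (u - s) + g' * (v - t))) with
      (g v - g t - (g' * (v - t) + 0 * (u - s))) by ring. exact Hd. }
replace (f' * g t) with (g t * f' + f s * 0) by ring.
replace (f s * g') with (g t * 0 + f s * g') by ring.
exact H.
Qed.

(** This is [exp (s + i t)]: [s] is the logarithm of the radius and [t] the angle, so rectangles are
    mapped to sectors of annuli. *)
Definition polar (s t : R) : C := (exp s * cos t, exp s * sin t).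

Lemma Cmod_polar s t : Cmod (polar s t) = exp s.
Proof.
unfold Cmod, polar; simpl.
replace (exp s * cos t * (exp s * cos t * 1) + exp s * sin t * (exp s * sin t * 1))
  with (exp s ^ 2 * (Rsqr (sin t) + Rsqr (cos t))) by (unfold Rsqr; ring).
rewrite sin2_cos2, Rmult_1_r. apply sqrt_pow2. left; apply exp_pos.
Qed.

(** The form is the imaginary part of [G (zeta) d zeta] for [G = g o exp] and [zeta = s + i t]; it
    is closed by the Cauchy-Riemann equations. *)
Lemma polar_closed_form (g : C -> C) (a b c d : R) :
  (forall s t, a <= s <= b -> c <= t <= d ->
     exists l, is_C_derive g (polar s t) l) ->
  closed_on_rectangle (fun s t => Im (g (polar s t))) (fun s t => Re (g (polar s t)))
    a b c d.
Proof.
intros H s t hs ht. destruct (H s t hs ht) as [l Hl].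
apply is_C_derive_2d in Hl. destruct Hl as [HR HI].
assert (hc : is_derive cos t (- sin t)) by (auto_derive; auto; ring).
assert (hn : is_derive sin t (cos t)) by (auto_derive; auto; ring).
assert (X := differentiable_pt_lim_prod _ _ _ _ _ _ (is_derive_exp s) hc).
assert (Y := differentiable_pt_lim_prod _ _ _ _ _ _ (is_derive_exp s) hn).
assert (CI := differentiable_pt_lim_comp _ _ _ _ _ _ _ _ _ _ _ HI X Y).
assert (CR := differentiable_pt_lim_comp _ _ _ _ _ _ _ _ _ _ _ HR X Y).
eexists; exists (Im l * (exp s * - sin t) + Re l * (exp s * cos t)); eexists.
split; [exact CI|].
replace (Im l * (exp s * - sin t) + Re l * (exp s * cos t))
  with (Re l * (exp s * cos t) + - Im l * (exp s * sin t)) by ring.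
exact CR.
Qed.

(** On [[a, b] x [0, 2 PI]] the edges [t = 0] and [t = 2 PI] have the same image and cancel. What
    remains of Goursat's theorem compares the integrals over the two circles. *)
Lemma polar_mean_value (g : C -> C) (a b : R) :
  a <= b ->
  (forall s t, a <= s <= b -> exists l, is_C_derive g (polar s t) l) ->
  ex_RInt (fun t => Re (g (polar b t)) - Re (g (polar a t))) 0 (2 * PI) /\
  RInt (fun t => Re (g (polar b t)) - Re (g (polar a t))) 0 (2 * PI) = 0.
Proof.
intros hab H.
assert (hpi := PI_RGT_0).
assert (Hcl : closed_on_rectangle (fun s t => Im (g (polar s t)))
                (fun s t => Re (g (polar s t))) a b 0 (2 * PI)).
{ apply polar_closed_form. auto. }
split.
- refine (ex_RInt_vertical _ (fun s t => Re (g (polar s t))) a b 0 (2 * PI) a b Hcl _ _ _); lra.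
- assert (G := goursat_rectangle _ _ a b 0 (2 * PI) hab ltac:(lra) Hcl).
  unfold boundary_integral in G.
  rewrite (RInt_ext (fun x => Im (g (polar x 0)) - Im (g (polar x (2 * PI)))) (fun _ => 0)) in G.
  + rewrite RInt_const in G. unfold scal in G; simpl in G.
    unfold mult in G; simpl in G. lra.
  + intros x _. unfold polar. rewrite cos_2PI, sin_2PI, cos_0, sin_0. apply Rminus_diag.
Qed.

(* The real part of [conj l * (f (w + z) - f w) / z] has the same mean over all
   circles [|z| = r]; as [r] tends to [0] the mean tends to [|l|^2]. *)
Lemma cauchy_estimate (f : C -> C) (w l : C) (r M : R) :
  0 < r ->
  (forall z, Cmod (z - w) < r -> exists l', is_C_derive f z l') ->
  (forall z, Cmod (z - w) < r -> Cmod (f z) <= M) ->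
  is_C_derive f w l -> Cmod l <= 2 * M / r.
Proof.
intros hr Hf HM Hl.
assert (hM : 0 <= M).
{ apply Rle_trans with (2 := HM w ltac:(rewrite Cmod_minus_diag; lra)). apply Cmod_ge_0. }
destruct (Req_dec (Cmod l) 0) as [l0 | l0].
{ rewrite l0. apply Rmult_le_pos; [lra|]. left; now apply Rinv_0_lt_compat. }
assert (hl : 0 < Cmod l) by (assert (T := Cmod_ge_0 l); lra).
apply Rnot_lt_le. intros Hlt.
set (gap := Cmod l - 2 * M / r).
assert (hgap : 0 < gap) by (unfold gap; lra).
set (eps := gap / 4).
(* The hypotheses hold on the open disc only, so the outer circle has radius [r' < r]. With
   [q = 2 M / r] and [t = q / (q + eps)], the radius [r t] would give exactly [q + eps]; the
   midpoint of [r t] and [r] is positive even if [M = 0]. *)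
assert (Hr' : exists r', 0 < r' < r /\ 2 * M / r' <= 2 * M / r + eps).
{ assert (heps : 0 < eps) by (unfold eps; lra).
  exists (r * (2 * M / r / (2 * M / r + eps) + 1) / 2).
  set (q := 2 * M / r).
  assert (hq : 0 <= q).
  { apply Rmult_le_pos; [lra|]. left; now apply Rinv_0_lt_compat. }
  assert (B : 0 <= q / (q + eps) < 1).
  { split.
    - apply Rmult_le_pos; auto. left; apply Rinv_0_lt_compat; lra.
    - apply (Rmult_lt_reg_r (q + eps)); [lra|]. field_simplify; lra. }
  set (t := q / (q + eps)) in *.
  assert (hrt : r * t < r * 1) by (apply Rmult_lt_compat_l; lra).
  assert (hrt0 : 0 <= r * t) by (apply Rmult_le_pos; lra).
  split; [split; lra|].
  apply (Rmult_le_reg_r (r * (t + 1) / 2)); [lra|].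
  replace (2 * M / (r * (t + 1) / 2) * (r * (t + 1) / 2)) with (q * r)
    by (unfold q; field; split; lra).
  replace (q * r) with (t * (q + eps) * r) by (unfold t; field; lra).
  replace ((q + eps) * (r * (t + 1) / 2)) with ((t + 1) / 2 * ((q + eps) * r)) by field.
  rewrite Rmult_assoc. apply Rmult_le_compat_r; [|lra].
  apply Rmult_le_pos; lra. }
destruct Hr' as [r' [hr' Hr']].
destruct (proj1 (is_C_derive_iff f w l) Hl eps ltac:(unfold eps; lra)) as [d [d0 Hd]].
(* On the inner circle the difference quotient is within [eps] of [l]; [d / 2] keeps that circle
   strictly inside the disc of radius [d]. *)
set (rho := Rmin (d / 2) r').
assert (hrho : 0 < rho) by (apply Rmin_pos; lra).
assert (hrho1 : rho <= d / 2) by apply Rmin_l.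
assert (hrho2 : rho <= r') by apply Rmin_r.
set (g := fun z => (Cconj l * (f (z + w) - f w) / z)%C).
assert (hab : ln rho <= ln r') by (apply ln_le; auto).
destruct (polar_mean_value g (ln rho) (ln r') hab) as [Hex Hint].
{ intros s t hs.
  assert (hp : polar s t <> 0%C). { apply Cmod_gt_0. rewrite Cmod_polar. apply exp_pos. }
  assert (hn : Cmod (polar s t + w - w) < r).
  { replace (polar s t + w - w)%C with (polar s t) by ring. rewrite Cmod_polar.
    apply Rle_lt_trans with r'; [|lra]. rewrite <- (exp_ln r') by lra.
    destruct (Rle_lt_or_eq_dec s (ln r')); [lra| left; now apply exp_increasing | subst; lra]. }
  destruct (Hf _ hn) as [l' Hl']. eexists.
  apply is_C_derive_div_id; auto. apply is_C_derive_scal.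
  apply is_C_derive_minus; [|apply is_C_derive_const].
  apply is_C_derive_shift. exact Hl'. }
assert (hpi := PI_RGT_0).
assert (hsz : 0 <= Cmod l) by lra.
assert (Up : forall t, Re (g (polar (ln r') t)) <= Cmod l * (2 * M / r')).
{ intros t. apply Rle_trans with (1 := Rle_abs _). apply Rle_trans with (1 := re_le_Cmod _).
  assert (mp : Cmod (polar (ln r') t) = r') by (rewrite Cmod_polar; apply exp_ln; lra).
  unfold g. rewrite Cmod_div, Cmod_mult, Cmod_conj, mp.
  2: { apply Cmod_gt_0. lra. }
  unfold Rdiv. rewrite Rmult_assoc. apply Rmult_le_compat_l; auto.
  apply Rmult_le_compat_r; [left; apply Rinv_0_lt_compat; lra|].
  apply Rle_trans with (1 := Cmod_minus_le _ _).
  assert (A := HM w ltac:(rewrite Cmod_minus_diag; lra)).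
  assert (B := HM (polar (ln r') t + w)%C).
  replace (polar (ln r') t + w - w)%C with (polar (ln r') t) in B by ring.
  rewrite mp in B. specialize (B ltac:(lra)). lra. }
assert (Lo : forall t, Cmod l * (Cmod l - eps) <= Re (g (polar (ln rho) t))).
{ intros t. set (z := polar (ln rho) t).
  assert (mp : Cmod z = rho) by (unfold z; rewrite Cmod_polar; apply exp_ln; lra).
  assert (hz : z <> 0%C) by (apply Cmod_gt_0; lra).
  specialize (Hd (z + w)%C).
  replace (z + w - w)%C with z in Hd by ring. rewrite mp in Hd.
  specialize (Hd ltac:(lra)).
  set (e := (f (z + w) - f w - l * z)%C) in *.
  assert (E : g z = (RtoC (Cmod l ^ 2) + Cconj l * e / z)%C).
  { replace (RtoC (Cmod l ^ 2)) with (l * Cconj l)%C by (symmetry; apply Cmod2_conj).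
    unfold g, e. field; auto. }
  rewrite E.
  assert (S : Rabs (Re (Cconj l * e / z)%C) <= Cmod l * eps).
  { apply Rle_trans with (1 := re_le_Cmod _).
    rewrite Cmod_div, Cmod_mult, Cmod_conj, mp; auto.
    unfold Rdiv. rewrite Rmult_assoc. apply Rmult_le_compat_l; auto.
    apply (Rmult_le_reg_r rho); auto. rewrite Rmult_assoc, Rinv_l; lra. }
  apply Rabs_le_between in S.
  replace (Re (RtoC (Cmod l ^ 2) + Cconj l * e / z)%C)
    with (Cmod l ^ 2 + Re (Cconj l * e / z)%C) by reflexivity.
  simpl pow. lra. }
(* The integrand is at most [|l| * (2 M / r + eps) - |l| * (|l| - eps)], which is the negative
   constant [- |l| * gap / 2], while its integral is 0. *)
assert (T : RInt (fun t => Re (g (polar (ln r') t)) - Re (g (polar (ln rho) t))) 0 (2 * PI) <=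
            RInt (fun _ => - (Cmod l * (gap / 2))) 0 (2 * PI)).
{ apply RInt_le; auto; [lra | apply ex_RInt_const |].
  intros t _. specialize (Up t). specialize (Lo t).
  assert (Cmod l * (2 * M / r') <= Cmod l * (2 * M / r + eps)) by now apply Rmult_le_compat_l.
  replace (- (Cmod l * (gap / 2))) with (Cmod l * (2 * M / r + eps) - Cmod l * (Cmod l - eps))
    by (unfold eps, gap; field; lra).
  lra. }
rewrite Hint, RInt_const in T. unfold scal in T; simpl in T. unfold mult in T; simpl in T.
assert (0 < 2 * PI * (Cmod l * (gap / 2))).
{ apply Rmult_lt_0_compat; [lra|]. apply Rmult_lt_0_compat; lra. }
lra.
Qed.

(** * Sequences of holomorphic functions *)

Definition disc (a : C) (r : R) (z : C) : Prop := Cmod (z - a) < r.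

Definition uniformly_cauchy (S : C -> Prop) (u : nat -> C -> C) : Prop :=
  forall eps, 0 < eps -> exists N : nat, forall n m, (N <= n)%nat -> (N <= m)%nat ->
    forall z, S z -> Cmod (u n z - u m z) <= eps.

Definition locally_uniformly_cauchy (Om : C -> Prop) (u : nat -> C -> C) : Prop :=
  forall w, Om w -> exists r, 0 < r /\ (forall z, disc w r z -> Om z) /\
    uniformly_cauchy (disc w r) u.

(** A total limit, taken componentwise, so that limit functions can be written down before
    convergence is known; it is meaningful for convergent sequences. *)
Definition C_lim_seq (v : nat -> C) : C :=
  (real (Lim_seq (fun n => Re (v n))), real (Lim_seq (fun n => Im (v n)))).

Lemma disc_center a r : 0 < r -> disc a r a.
Proof. intros h. unfold disc. now rewrite Cmod_minus_diag. Qed.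

Lemma disc_sub a b r s z : Cmod (b - a) + s <= r -> disc b s z -> disc a r z.
Proof.
unfold disc. intros h hz. apply Rle_lt_trans with (1 := Cmod_triangle_minus z b a). lra.
Qed.

Lemma disc_convex a r p q (t : R) :
  disc a r p -> disc a r q -> 0 <= t <= 1 -> disc a r (p + t * (q - p))%C.
Proof.
unfold disc. intros hp hq ht.
replace (p + t * (q - p) - a)%C with (RtoC (1 - t) * (p - a) + t * (q - a))%C.
2: { rewrite RtoC_minus. ring. }
apply Rle_lt_trans with (1 := Cmod_triangle _ _).
rewrite !Cmod_mult, !Cmod_RtoC_nonneg by lra.
destruct (Req_dec t 0) as [-> | h].
- lra.
- assert (t * Cmod (q - a) < t * r) by (apply Rmult_lt_compat_l; lra).
  assert ((1 - t) * Cmod (p - a) <= (1 - t) * r) by (apply Rmult_le_compat_l; lra).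
  lra.
Qed.

Lemma uniformly_cauchy_sub (S T : C -> Prop) u :
  (forall z, T z -> S z) -> uniformly_cauchy S u -> uniformly_cauchy T u.
Proof.
intros h H eps heps. destruct (H eps heps) as [N HN]. exists N. auto.
Qed.

(** The predicate [eq w] is the singleton of [w], so [uniformly_cauchy (eq w)] expresses the Cauchy
    property at one point. *)
Lemma locally_uniformly_cauchy_at Om u w :
  locally_uniformly_cauchy Om u -> Om w -> uniformly_cauchy (eq w) u.
Proof.
intros H hw. destruct (H w hw) as [r [hr [_ Hr]]].
apply uniformly_cauchy_sub with (2 := Hr). intros z <-. now apply disc_center.
Qed.

(** Letting [m] tend to infinity keeps a non-strict bound, so the limit inherits the same [eps] and
    [N]; hence both are given as data. *)
Lemma uniformly_cauchy_C_lim (S : C -> Prop) u :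
  uniformly_cauchy S u ->
  forall eps N, (forall n m, (N <= n)%nat -> (N <= m)%nat ->
      forall z, S z -> Cmod (u n z - u m z) <= eps) ->
    forall n z, (N <= n)%nat -> S z ->
      Cmod (u n z - C_lim_seq (fun m => u m z)) <= eps.
Proof.
intros H eps N HN n z hn hz.
(* [p] stands for [Re] and [Im], which are treated together. *)
assert (E : forall p : C -> R, (forall x, Rabs (p x) <= Cmod x) ->
  (forall x y, p (x - y)%C = p x - p y) ->
  is_lim_seq (fun m => p (u m z)) (real (Lim_seq (fun m => p (u m z))))).
{ intros p hp hsub. apply Lim_seq_correct', ex_lim_seq_cauchy_corr.
  intros e. assert (he := cond_pos e). destruct (H (e / 2) ltac:(lra)) as [K HK].
  exists K. intros i j hi hj. rewrite <- hsub.
  apply Rle_lt_trans with (1 := hp _). specialize (HK i j hi hj z hz). lra. }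
assert (ER := E Re re_le_Cmod (fun x y => eq_refl)).
assert (EI := E Im im_le_Cmod (fun x y => eq_refl)).
apply le_epsilon. intros e he.
apply is_lim_seq_spec in ER, EI.
assert (h4 : 0 < e / 2) by lra.
destruct (ER (mkposreal _ h4)) as [N1 H1]. destruct (EI (mkposreal _ h4)) as [N2 H2].
simpl in H1, H2.
set (m := Nat.max N (Nat.max N1 N2)).
specialize (H1 m ltac:(lia)). specialize (H2 m ltac:(lia)).
specialize (HN n m hn ltac:(lia) z hz).
apply Rle_trans with (1 := Cmod_triangle_minus _ (u m z) _).
assert (T : Cmod (u m z - C_lim_seq (fun m => u m z)) <= e).
{ apply Rle_trans with (1 := Cmod_le_Re_Im _).
  change (Re (u m z - C_lim_seq (fun m => u m z))%C)
    with (Re (u m z) - real (Lim_seq (fun m => Re (u m z)))).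
  change (Im (u m z - C_lim_seq (fun m => u m z))%C)
    with (Im (u m z) - real (Lim_seq (fun m => Im (u m z)))).
  lra. }
lra.
Qed.

Lemma C_lim_seq_unique (v : nat -> C) (l : C) :
  (forall eps, 0 < eps -> exists N : nat, forall n, (N <= n)%nat -> Cmod (v n - l) <= eps) ->
  C_lim_seq v = l.
Proof.
intros H.
assert (E : forall p : C -> R, (forall x, Rabs (p x) <= Cmod x) ->
  (forall x y, p (x - y)%C = p x - p y) ->
  real (Lim_seq (fun m => p (v m))) = p l).
{ intros p hp hsub. rewrite (is_lim_seq_unique _ (Finite (p l))); [reflexivity|].
  apply is_lim_seq_spec. intros e. assert (he := cond_pos e).
  destruct (H (e / 2) ltac:(lra)) as [N HN]. exists N. intros n hn.
  rewrite <- hsub. apply Rle_lt_trans with (1 := hp _). specialize (HN n hn). lra. }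
unfold C_lim_seq. rewrite (E Re re_le_Cmod (fun x y => eq_refl)).
rewrite (E Im im_le_Cmod (fun x y => eq_refl)). now destruct l.
Qed.

Lemma holomorphic_is_derive Om f z :
  holomorphic_on Om f -> Om z -> is_C_derive f z (C_derive f z).
Proof. intros H hz. apply C_derive_correct; auto. Qed.

Lemma holomorphic_sub Om Om' f :
  (forall z, Om' z -> Om z) -> holomorphic_on Om f -> holomorphic_on Om' f.
Proof. intros h H z hz. auto. Qed.

(** The disc of radius [r - rho] about a point of the smaller disc lies in the larger one. *)
Lemma cauchy_estimate_disc f a r rho M :
  rho < r -> holomorphic_on (disc a r) f ->
  (forall z, disc a r z -> Cmod (f z) <= M) ->
  forall w l, disc a rho w -> is_C_derive f w l -> Cmod l <= 2 * M / (r - rho).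
Proof.
intros hr Hf HM w l hw Hl.
assert (hs : forall z, Cmod (z - w) < r - rho -> disc a r z).
{ intros z hz. apply disc_sub with w (r - rho); auto. unfold disc in hw. lra. }
apply cauchy_estimate with f w; auto; [lra|].
intros z hz. exact (Hf z (hs z hz)).
Qed.

Lemma lipschitz_disc f a r M :
  holomorphic_on (disc a r) f ->
  (forall z, disc a r z -> Cmod (C_derive f z) <= M) ->
  forall p q, disc a r p -> disc a r q -> Cmod (f q - f p) <= M * Cmod (q - p).
Proof.
intros Hf HM p q hp hq.
apply C_mean_value with (C_derive f). intros t ht.
assert (h := disc_convex a r p q t hp hq ht).
split; auto. now apply (holomorphic_is_derive (disc a r)).
Qed.

Lemma lipschitz_disc_minus f g a r M :
  holomorphic_on (disc a r) f -> holomorphic_on (disc a r) g ->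
  (forall z, disc a r z -> Cmod (C_derive f z - C_derive g z) <= M) ->
  forall p q, disc a r p -> disc a r q ->
    Cmod ((f q - g q) - (f p - g p)) <= M * Cmod (q - p).
Proof.
intros Hf Hg HM p q hp hq.
assert (D : forall z, disc a r z ->
  is_C_derive (fun z => f z - g z)%C z (C_derive f z - C_derive g z)%C).
{ intros z hz. apply is_C_derive_minus; now apply (holomorphic_is_derive (disc a r)). }
apply (lipschitz_disc (fun z => f z - g z)%C a r M); auto.
- intros z hz. eexists. now apply D.
- intros z hz. rewrite (is_C_derive_unique (fun z => f z - g z)%C z _ (D z hz)). auto.
Qed.

(** Cauchy's estimate for [u n - u m] costs the factor [2 / (r - rho)], which the choice of the
    threshold compensates. *)
Lemma uniformly_cauchy_derive u a r rho :
  rho < r -> (forall n, holomorphic_on (disc a r) (u n)) ->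
  uniformly_cauchy (disc a r) u ->
  uniformly_cauchy (disc a rho) (fun n => C_derive (u n)).
Proof.
intros hr Hu H eps heps.
destruct (H (eps * (r - rho) / 2)) as [N HN].
{ assert (0 < eps * (r - rho)) by (apply Rmult_lt_0_compat; lra). lra. }
exists N. intros n m hn hm z hz.
assert (D : forall z, disc a r z ->
  is_C_derive (fun z => u n z - u m z)%C z (C_derive (u n) z - C_derive (u m) z)%C).
{ intros z' hz'. apply is_C_derive_minus; now apply (holomorphic_is_derive (disc a r)). }
replace eps with (2 * (eps * (r - rho) / 2) / (r - rho)) by (field; lra).
apply (cauchy_estimate_disc (fun z => u n z - u m z)%C a r rho) with z; auto.
- intros z' hz'. eexists. now apply D.
- apply D. unfold disc in *; lra.
Qed.

(** The remainder of the limit at [a] is split into the remainder of one [u N], the error of its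
    derivative at [a], and the increment of [u N - L]. Each receives a third of [eps]. *)
Lemma weierstrass u a r :
  0 < r -> (forall n, holomorphic_on (disc a r) (u n)) ->
  uniformly_cauchy (disc a r) u ->
  is_C_derive (fun z => C_lim_seq (fun n => u n z)) a (C_lim_seq (fun n => C_derive (u n) a)).
Proof.
intros hr Hu H.
assert (Hd := uniformly_cauchy_derive u a r (r / 2) ltac:(lra) Hu H).
assert (hsub : forall z, disc a (r / 2) z -> disc a r z) by (unfold disc; intros; lra).
assert (H2 := uniformly_cauchy_sub _ (disc a (r / 2)) u hsub H).
assert (ha : disc a (r / 2) a) by (apply disc_center; lra).
apply is_C_derive_iff. intros eps heps.
set (e := eps / 3). assert (he : 0 < e) by (unfold e; lra).
destruct (Hd e he) as [N HN].
assert (HNl := uniformly_cauchy_C_lim _ _ Hd e N HN N a (Nat.le_refl N) ha).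
assert (HuN := holomorphic_is_derive _ _ a (Hu N) (disc_center a r hr)).
destruct (proj1 (is_C_derive_iff _ _ _) HuN e he) as [d [d0 Hdd]].
exists (Rmin d (r / 2)). split; [apply Rmin_pos; lra|].
intros w hw.
assert (hw1 : Cmod (w - a) < d) by (apply Rlt_le_trans with (1 := hw); apply Rmin_l).
assert (hw2 : disc a (r / 2) w) by (apply Rlt_le_trans with (1 := hw); apply Rmin_r).
specialize (Hdd w hw1).
set (L := fun z => C_lim_seq (fun n => u n z)).
set (D := C_lim_seq (fun n => C_derive (u n) a)) in *.
change (Cmod (L w - L a - D * (w - a)) <= eps * Cmod (w - a)).
(* The mean value inequality bounds the increment of [u N - u m] uniformly in large [m]; then [m]
   tends to infinity. *)
assert (K : Cmod ((u N w - L w) - (u N a - L a)) <= e * Cmod (w - a)).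
{ apply le_epsilon. intros e' he'.
  destruct (H2 (e' / 2) ltac:(lra)) as [N' HN'].
  set (m := Nat.max N N').
  assert (A := uniformly_cauchy_C_lim _ _ H2 (e' / 2) N' HN' m w ltac:(lia) hw2).
  assert (B := uniformly_cauchy_C_lim _ _ H2 (e' / 2) N' HN' m a ltac:(lia) ha).
  fold (L w) in A. fold (L a) in B.
  assert (T : Cmod ((u N w - u m w) - (u N a - u m a)) <= e * Cmod (w - a)).
  { apply (lipschitz_disc_minus (u N) (u m) a (r / 2)); auto.
    - apply holomorphic_sub with (1 := hsub); auto.
    - apply holomorphic_sub with (1 := hsub); auto.
    - intros z hz. apply HN; auto; lia. }
  replace (u N w - L w - (u N a - L a))%C
    with ((u N w - u m w - (u N a - u m a)) + ((u m w - L w) - (u m a - L a)))%C by ring.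
  apply Rle_trans with (1 := Cmod_triangle _ _).
  assert (X := Cmod_minus_le (u m w - L w) (u m a - L a)). lra. }
replace (L w - L a - D * (w - a))%C with
  ((u N w - u N a - C_derive (u N) a * (w - a)) +
   ((C_derive (u N) a - D) * (w - a) - (u N w - L w - (u N a - L a))))%C by ring.
apply Rle_trans with (1 := Cmod_triangle _ _).
assert (X := Cmod_minus_le ((C_derive (u N) a - D) * (w - a)) (u N w - L w - (u N a - L a))).
rewrite Cmod_mult in X.
assert (Y : Cmod (C_derive (u N) a - D) * Cmod (w - a) <= e * Cmod (w - a)).
{ apply Rmult_le_compat_r; auto. apply Cmod_ge_0. }
replace (eps * Cmod (w - a)) with (e * Cmod (w - a) + e * Cmod (w - a) + e * Cmod (w - a))
  by (unfold e; field).
lra.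
Qed.

(** * Derivatives of holomorphic functions are holomorphic *)

Lemma disc_locally a r : 0 < r -> locally (T := AbsRing_UniformSpace C_AbsRing) a (disc a r).
Proof. intros hr. exists (mkposreal r hr). intros z hz. exact hz. Qed.

Lemma is_C_derive_ext_disc (f g : C -> C) a r l :
  0 < r -> (forall z, disc a r z -> f z = g z) -> is_C_derive f a l -> is_C_derive g a l.
Proof.
intros hr H. apply is_derive_ext_loc.
assert (L := disc_locally a r hr). revert L. apply filter_imp. exact H.
Qed.

(** Provides the bound that Cauchy's estimate asks for, from the definition of the derivative with
    [eps = 1]. *)
Lemma differentiable_locally_bounded f a l :
  is_C_derive f a l -> exists r M, 0 < r /\ forall z, disc a r z -> Cmod (f z) <= M.
Proof.
intros H. destruct (proj1 (is_C_derive_iff f a l) H 1 Rlt_0_1) as [d [d0 Hd]].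
exists (Rmin d 1), (Cmod (f a) + (Cmod l + 1)). split; [apply Rmin_pos; lra|].
intros z hz. unfold disc in hz.
assert (h1 := Rmin_l d 1). assert (h2 := Rmin_r d 1).
specialize (Hd z ltac:(lra)).
replace (f z) with (f a + (l * (z - a) + (f z - f a - l * (z - a))))%C by ring.
apply Rle_trans with (1 := Cmod_triangle _ _). apply Rplus_le_compat_l.
apply Rle_trans with (1 := Cmod_triangle _ _). rewrite Cmod_mult.
assert (Cmod l * Cmod (z - a) <= Cmod l * 1).
{ apply Rmult_le_compat_l; [apply Cmod_ge_0 | lra]. }
lra.
Qed.

(* On [disc a r] the derivative is the uniform limit of the difference quotients
   [(f (z + h) - f z) / h], because Cauchy's estimate, applied first to [f] and
   then to [f (z + h) - f z], makes [f] and then [C_derive f] Lipschitz. *)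
Lemma ex_derive_C_derive f a r M :
  0 < r -> holomorphic_on (disc a (4 * r)) f ->
  (forall z, disc a (4 * r) z -> Cmod (f z) <= M) ->
  exists l, is_C_derive (C_derive f) a l.
Proof.
intros hr Hf HM.
(* The radii [4 r], [3 r], [2 r], [r] leave a margin [r] for each use of Cauchy's estimate and for
   each shift by [h]. *)
assert (Df := fun z => holomorphic_is_derive (disc a (4 * r)) f z Hf).
assert (S : forall s t z, s <= t -> disc a s z -> disc a t z) by (unfold disc; intros; lra).
assert (Sh : forall s z h, disc a s z -> Cmod h < r -> disc a (s + r) (z + h)%C).
{ unfold disc. intros s z h hz hh. replace (z + h - a)%C with ((z - a) + h)%C by ring.
  apply Rle_lt_trans with (1 := Cmod_triangle _ _). lra. }
set (M1 := 2 * M / r).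
assert (L1 : forall p q, disc a (3 * r) p -> disc a (3 * r) q ->
  Cmod (f q - f p) <= M1 * Cmod (q - p)).
{ apply lipschitz_disc.
  - apply holomorphic_sub with (2 := Hf). intros z hz. apply S with (3 * r); auto; lra.
  - intros z hz. unfold M1. replace r with (4 * r - 3 * r) by ring.
    apply cauchy_estimate_disc with f a z; auto; [lra|].
    apply Df. apply S with (3 * r); auto; lra. }
set (M2 := 2 * M1 / r).
assert (hM1 : 0 <= M1).
{ apply Rmult_le_pos; [|left; now apply Rinv_0_lt_compat].
  assert (T := HM a ltac:(apply disc_center; lra)). assert (T2 := Cmod_ge_0 (f a)). lra. }
assert (hM2 : 0 <= M2).
{ apply Rmult_le_pos; [lra | left; now apply Rinv_0_lt_compat]. }
assert (L2 : forall z h, disc a r z -> Cmod h < r ->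
  Cmod (C_derive f (z + h)%C - C_derive f z) <= M2 * Cmod h).
{ intros z h hz hh. unfold M2.
  assert (D : forall z, disc a (2 * r) z ->
    is_C_derive (fun z => f (z + h) - f z)%C z (C_derive f (z + h)%C - C_derive f z)%C).
  { intros x hx. apply is_C_derive_minus.
    - apply is_C_derive_shift, Df. apply S with (2 * r + r); [lra | auto].
    - apply Df. apply S with (2 * r); auto; lra. }
  replace (2 * M1 / r * Cmod h) with (2 * (M1 * Cmod h) / (2 * r - r)) by (field; lra).
  apply cauchy_estimate_disc with (fun z => f (z + h) - f z)%C a z; auto; [lra | | |].
  - intros x hx. eexists. now apply D.
  - intros x hx. assert (T := L1 x (x + h)%C).
    replace (x + h - x)%C with h in T by ring.
    apply T.
    + apply S with (2 * r); auto; lra.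
    + apply S with (2 * r + r); [lra | auto].
  - apply D. apply S with r; auto; lra. }
(* The mean value inequality is applied to [f x - f' z * x], whose derivative [f' x - f' z] is small
   by [L2]. *)
assert (Q : forall z h, disc a r z -> 0 < Cmod h < r ->
  Cmod ((f (z + h)%C - f z) / h - C_derive f z) <= M2 * Cmod h).
{ intros z h hz hh.
  assert (h0 : h <> 0%C) by now apply Cmod_gt_0.
  assert (T : Cmod ((f (z + h)%C - C_derive f z * (z + h)) - (f z - C_derive f z * z))
              <= M2 * Cmod h * Cmod (z + h - z)).
  { apply (C_mean_value (fun x => f x - C_derive f z * x)%C (fun x => C_derive f x - C_derive f z)%C).
    intros t ht. replace (z + t * (z + h - z))%C with (z + t * h)%C by ring.
    assert (hth : Cmod (t * h) <= Cmod h).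
    { rewrite Cmod_mult, Cmod_RtoC_nonneg by lra.
      rewrite <- (Rmult_1_l (Cmod h)) at 2. apply Rmult_le_compat_r; lra. }
    split.
    - apply is_C_derive_minus; [|apply is_C_derive_linear].
      apply Df. apply S with (r + r); [lra|]. apply Sh; auto. lra.
    - apply Rle_trans with (1 := L2 z (t * h)%C hz ltac:(lra)).
      now apply Rmult_le_compat_l. }
  replace (z + h - z)%C with h in T by ring.
  replace ((f (z + h)%C - f z) / h - C_derive f z)%C with
    (((f (z + h)%C - C_derive f z * (z + h)) - (f z - C_derive f z * z)) / h)%C by (field; auto).
  rewrite Cmod_div by auto.
  apply (Rmult_le_reg_r (Cmod h)); [lra|]. field_simplify; [|lra]. lra. }
(* A null sequence of increments; [+ 2] keeps every modulus strictly below [r]. *)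
set (h := fun n : nat => RtoC (r / (INR n + 2))).
assert (hh : forall n, Cmod (h n) = r / (INR n + 2)).
{ intros n. apply Cmod_RtoC_nonneg. assert (T := pos_INR n).
  apply Rmult_le_pos; [lra | left; apply Rinv_0_lt_compat; lra]. }
assert (hh2 : forall n, 0 < Cmod (h n) < r).
{ intros n. rewrite hh. assert (T := pos_INR n). split.
  - apply Rdiv_lt_0_compat; lra.
  - apply (Rmult_lt_reg_r (INR n + 2)); [lra|]. field_simplify; [|lra].
    assert (0 <= r * INR n) by (apply Rmult_le_pos; lra). lra. }
assert (hlim : forall eps, 0 < eps -> exists N : nat, forall n, (N <= n)%nat ->
   M2 * Cmod (h n) <= eps).
{ intros eps heps. destruct (nfloor_ex (M2 * r / eps)) as [N HN].
  { apply Rmult_le_pos; [apply Rmult_le_pos; lra | left; now apply Rinv_0_lt_compat]. }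
  exists N. intros n hn. rewrite hh. apply le_INR in hn. assert (T := pos_INR n).
  apply (Rmult_le_reg_r (INR n + 2)); [lra|].
  replace (M2 * (r / (INR n + 2)) * (INR n + 2)) with (eps * (M2 * r / eps)) by (field; lra).
  apply Rmult_le_compat_l; lra. }
set (q := fun n z => ((f (z + h n) - f z) / h n)%C).
(* The derivative comes from [weierstrass] applied to the difference quotients [q n], whose uniform
   limit is [C_derive f]. *)
exists (C_lim_seq (fun n => C_derive (q n) a)).
apply is_C_derive_ext_disc with (fun z => C_lim_seq (fun n => q n z)) r; auto.
- intros z hz. apply C_lim_seq_unique. intros eps heps.
  destruct (hlim eps heps) as [N HN]. exists N. intros n hn.
  apply Rle_trans with (2 := HN n hn). unfold q. auto.
- apply weierstrass with r; auto.
  + intros n z hz. unfold q. eexists.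
    apply (is_derive_ext (K := C_AbsRing) (V := C_NormedModule)
             (fun z => / h n * (f (z + h n) - f z))%C).
    { intros t. apply Cmult_comm. }
    apply is_C_derive_scal. apply is_C_derive_minus.
    * apply is_C_derive_shift, Df. apply S with (r + r); [lra|]. apply Sh; auto. apply hh2.
    * apply Df. apply S with r; auto; lra.
  + intros eps heps. destruct (hlim (eps / 2) ltac:(lra)) as [N HN]. exists N.
    intros n m hn hm z hz.
    assert (A := Q z (h n) hz (hh2 n)). assert (B := Q z (h m) hz (hh2 m)).
    fold (q n z) in A. fold (q m z) in B.
    apply Rle_trans with (1 := Cmod_triangle_minus _ (C_derive f z) _).
    rewrite (Cmod_minus_sym (C_derive f z)).
    specialize (HN n hn) as HN1. specialize (HN m hm). lra.
Qed.

Lemma holomorphic_C_derive Om f :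
  open_C Om -> holomorphic_on Om f -> holomorphic_on Om (C_derive f).
Proof.
intros hOm Hf a ha.
destruct (proj1 (open_C_iff Om) hOm a ha) as [r1 [hr1 H1]].
destruct (differentiable_locally_bounded f a _ (holomorphic_is_derive Om f a Hf ha))
  as [r2 [M [hr2 H2]]].
assert (T1 := Rmin_l r1 r2). assert (T2 := Rmin_r r1 r2).
assert (T3 : 0 < Rmin r1 r2) by now apply Rmin_pos.
apply ex_derive_C_derive with (Rmin r1 r2 / 4) M; [lra | |].
- intros z hz. apply Hf, H1. unfold disc in hz. lra.
- intros z hz. apply H2. unfold disc in *. lra.
Qed.

Lemma holomorphic_C_deriv_n Om f l :
  open_C Om -> holomorphic_on Om f -> holomorphic_on Om (C_deriv_n f l).
Proof.
intros hOm Hf. induction l as [|l IH]; [exact Hf|].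
now apply (holomorphic_C_derive Om (C_deriv_n f l)).
Qed.

(** * Cauchy sequences: from functions to derivatives and back *)

Lemma locally_uniformly_cauchy_derive Om u :
  (forall n, holomorphic_on Om (u n)) ->
  locally_uniformly_cauchy Om u ->
  locally_uniformly_cauchy Om (fun n => C_derive (u n)).
Proof.
intros Hu H w hw. destruct (H w hw) as [r [hr [hs Hr]]].
exists (r / 2). split; [lra|]. split.
- intros z hz. apply hs. unfold disc in *; lra.
- apply uniformly_cauchy_derive with r; auto; [lra|].
  intros n. apply holomorphic_sub with (1 := hs); auto.
Qed.

(** The mean value inequality carries the Cauchy property from [p] to any point of the disc, at
    distance at most [2 r]. *)
Lemma uniformly_cauchy_primitive u a r p :
  (forall n, holomorphic_on (disc a r) (u n)) ->
  uniformly_cauchy (disc a r) (fun n => C_derive (u n)) ->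
  disc a r p -> uniformly_cauchy (eq p) u -> uniformly_cauchy (disc a r) u.
Proof.
intros Hu Hd hp Hp eps heps.
assert (hr : 0 < r) by (apply Rle_lt_trans with (2 := hp); apply Cmod_ge_0).
assert (hc : 0 < eps / 2 / (2 * r)) by (apply Rdiv_lt_0_compat; lra).
destruct (Hp (eps / 2) ltac:(lra)) as [N1 H1].
destruct (Hd (eps / 2 / (2 * r)) hc) as [N2 H2].
exists (Nat.max N1 N2). intros n m hn hm z hz.
specialize (H1 n m ltac:(lia) ltac:(lia) p eq_refl).
assert (T := lipschitz_disc_minus (u n) (u m) a r _ (Hu n) (Hu m)
  (fun z hz => H2 n m ltac:(lia) ltac:(lia) z hz) p z hp hz).
replace (u n z - u m z)%C with
  ((u n z - u m z - (u n p - u m p)) + (u n p - u m p))%C by ring.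
apply Rle_trans with (1 := Cmod_triangle _ _).
assert (hzp : Cmod (z - p) <= 2 * r).
{ apply Rle_trans with (1 := Cmod_triangle_minus z a p).
  rewrite (Cmod_minus_sym a p). unfold disc in *. lra. }
assert (eps / 2 / (2 * r) * Cmod (z - p) <= eps / 2 / (2 * r) * (2 * r)).
{ apply Rmult_le_compat_l; lra. }
replace (eps / 2 / (2 * r) * (2 * r)) with (eps / 2) in * by (field; lra).
lra.
Qed.

(* The points near which [u] is uniformly Cauchy and the points near which it is
   nowhere Cauchy form two disjoint open sets covering [Om]. *)
Lemma locally_uniformly_cauchy_connected Om A u z0 :
  (forall n, holomorphic_on Om (u n)) ->
  locally_uniformly_cauchy Om (fun n => C_derive (u n)) ->
  connected A -> (forall z, A z -> Om z) ->
  A z0 -> uniformly_cauchy (eq z0) u ->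
  forall w, A w -> exists r, 0 < r /\ (forall z, disc w r z -> Om z) /\
    uniformly_cauchy (disc w r) u.
Proof.
intros Hu Hd HA hA hz0 Hz0 w hw.
set (U := fun w => exists r, 0 < r /\ (forall z, disc w r z -> Om z) /\
    uniformly_cauchy (disc w r) u).
set (V := fun w => exists r, 0 < r /\ forall p, disc w r p -> ~ uniformly_cauchy (eq p) u).
change (U w).
assert (sub : forall w r w', disc w r w' ->
  0 < r - Cmod (w' - w) /\ forall z, Cmod (z - w') < r - Cmod (w' - w) -> disc w r z).
{ intros x r x' hx. unfold disc in hx. split; [lra|]. intros z hz.
  apply disc_sub with x' (r - Cmod (x' - x)); auto; lra. }
assert (oU : open_C U).
{ apply open_C_iff. intros x [r [hr [h1 h2]]]. exists r; split; auto.
  intros x' hx'. destruct (sub x r x' hx') as [p1 p2].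
  exists (r - Cmod (x' - x)). split; auto. split; auto.
  apply uniformly_cauchy_sub with (2 := h2). exact p2. }
assert (oV : open_C V).
{ apply open_C_iff. intros x [r [hr h1]]. exists r; split; auto.
  intros x' hx'. destruct (sub x r x' hx') as [p1 p2].
  exists (r - Cmod (x' - x)). split; auto. }
(* A single Cauchy point suffices on a disc where the derivatives are uniformly Cauchy. *)
assert (cov : forall x, Om x -> forall p r, 0 < r -> (forall z, disc x r z -> Om z) ->
  uniformly_cauchy (disc x r) (fun n => C_derive (u n)) ->
  disc x r p -> uniformly_cauchy (eq p) u -> U x).
{ intros x hx p r hr hs hd hp Hp. exists r. split; auto. split; auto.
  apply uniformly_cauchy_primitive with p; auto.
  intros n. apply holomorphic_sub with (1 := hs); auto. }
assert (UV : forall x, A x -> U x \/ V x).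
{ intros x hx. destruct (Hd x (hA x hx)) as [r [hr [hs h]]].
  destruct (classic (exists p, disc x r p /\ uniformly_cauchy (eq p) u)) as [[p [hp Hp]] | no].
  - left. apply cov with p r; auto.
  - right. exists r. split; auto. intros p hp Hp. apply no. now exists p. }
destruct (UV w hw) as [|hV]; auto.
exfalso.
(* With [z0] in [U] and [w] in [V], connectedness yields a point of both, at which [u] is Cauchy and
   not Cauchy. *)
destruct (HA U V oU oV UV) as [x [_ [[r [hr [_ h1]]] [s [hs h2]]]]].
- exists z0. split; auto. destruct (Hd z0 (hA z0 hz0)) as [r [hr [hs h]]].
  apply cov with z0 r; auto. now apply disc_center.
- exists w. auto.
- apply (h2 x); [now apply disc_center|].
  apply uniformly_cauchy_sub with (2 := h1). intros z <-. now apply disc_center.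
Qed.

(** The component is the union of all connected subsets of [Om] through [w]; it is connected because
    they share [w]. *)
Lemma component_exists (Om : C -> Prop) w :
  Om w -> exists A, is_component Om A /\ A w.
Proof.
intros hw.
exists (fun z => exists B : C -> Prop, connected B /\ (forall x, B x -> Om x) /\ B w /\ B z).
assert (hww : exists B : C -> Prop, connected B /\ (forall x, B x -> Om x) /\ B w /\ B w).
{ exists (eq w). split; [|repeat split; auto].
  - intros U V _ _ _ [x [<- hU]] [y [<- hV]]. now exists w.
  - now intros x <-. }
split; [split; [|split; [|split]] | exact hww].
- now exists w.
- intros z [B [_ [h [_ hz]]]]. auto.
- intros U V oU oV cov [x [[B [cB [sB [wB xB]]]] hU]] [y [[D [cD [sD [wD yD]]]] hV]].
  (* If [w] lies in [U], the set joining [w] to the point of [V] is used, and conversely. *)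
  destruct (cov w hww) as [wU | wV].
  + destruct (cD U V oU oV) as [p [pD pUV]]; eauto.
    { intros q hq. apply cov. now exists D. }
    exists p. split; auto. now exists D.
  + destruct (cB U V oU oV) as [p [pB pUV]]; eauto.
    { intros q hq. apply cov. now exists B. }
    exists p. split; auto. now exists B.
- intros B cB hB sB z hz. exists B. repeat split; auto.
Qed.

(** * The space of holomorphic functions with bounded derivatives *)

(** A derivative depends only on values near the point, so an identity on the open set [Om] can be
    differentiated. This is the induction step of the formulas for [C_deriv_n]. *)
Lemma C_deriv_n_S_ext Om f g l z d :
  open_C Om -> Om z -> (forall w, Om w -> C_deriv_n f l w = g w) ->
  is_C_derive g z d -> C_deriv_n f (S l) z = d.
Proof.
intros hOm hz H Hd. apply (is_C_derive_unique (C_deriv_n f l)).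
destruct (proj1 (open_C_iff Om) hOm z hz) as [r [hr Hr]].
apply is_C_derive_ext_disc with g r; auto.
intros w hw. symmetry. auto.
Qed.

Lemma C_deriv_n_is_derive Om f l z :
  open_C Om -> holomorphic_on Om f -> Om z ->
  is_C_derive (C_deriv_n f l) z (C_deriv_n f (S l) z).
Proof.
intros hOm Hf hz.
apply (holomorphic_is_derive Om); auto. now apply holomorphic_C_deriv_n.
Qed.

Lemma C_deriv_n_fadd Om f g l z :
  open_C Om -> holomorphic_on Om f -> holomorphic_on Om g -> Om z ->
  C_deriv_n (fadd f g) l z = (C_deriv_n f l z + C_deriv_n g l z)%C.
Proof.
intros hOm Hf Hg. revert z. induction l as [|l IH]; intros z hz; [reflexivity|].
apply (C_deriv_n_S_ext Om _ _ _ _ _ hOm hz IH).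
apply is_C_derive_plus; now apply (C_deriv_n_is_derive Om).
Qed.

Lemma C_deriv_n_fscal Om c f l z :
  open_C Om -> holomorphic_on Om f -> Om z ->
  C_deriv_n (fscal c f) l z = (c * C_deriv_n f l z)%C.
Proof.
intros hOm Hf. revert z. induction l as [|l IH]; intros z hz; [reflexivity|].
apply (C_deriv_n_S_ext Om _ _ _ _ _ hOm hz IH).
apply is_C_derive_scal; now apply (C_deriv_n_is_derive Om).
Qed.

Lemma fsub_fadd_fscal f g : fsub f g = fadd f (fscal (-1)%C g).
Proof. apply functional_extensionality. intros z. unfold fsub, fadd, fscal. ring. Qed.

Lemma holomorphic_fscal Om c f : holomorphic_on Om f -> holomorphic_on Om (fscal c f).
Proof.
intros H z hz. eexists. apply is_C_derive_scal. now apply (holomorphic_is_derive Om).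
Qed.

Lemma C_deriv_n_fsub Om f g l z :
  open_C Om -> holomorphic_on Om f -> holomorphic_on Om g -> Om z ->
  C_deriv_n (fsub f g) l z = (C_deriv_n f l z - C_deriv_n g l z)%C.
Proof.
intros hOm Hf Hg hz. rewrite fsub_fadd_fscal.
rewrite (C_deriv_n_fadd Om), (C_deriv_n_fscal Om); auto using holomorphic_fscal. ring.
Qed.

Lemma H_F_infty_subspace Om F : open_C Om -> is_subspace (H_F_infty Om F).
Proof.
intros hOm.
assert (h0 : holomorphic_on Om (fun _ => 0%C)).
{ intros z _. eexists. apply is_C_derive_const. }
split; [|split].
- split; [|split]; auto. intros l _. exists 0. intros z hz.
  (* Writing the zero function as [0 * 0] makes its derivatives computable by the rule for scalar
     multiples. *)
  replace (fun _ : C => RtoC 0) with (fscal 0%C (fun _ => 0%C)).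
  + rewrite (C_deriv_n_fscal Om); auto. rewrite Cmult_0_l, Cmod_0. lra.
  + apply functional_extensionality. intros; unfold fscal; ring.
- intros f g [f0 [Hf Bf]] [g0 [Hg Bg]]. split; [|split].
  + intros z hz. unfold fadd. rewrite f0, g0 by auto. ring.
  + intros z hz. eexists. apply is_C_derive_plus; now apply (holomorphic_is_derive Om).
  + intros l hl. destruct (Bf l hl) as [M HM], (Bg l hl) as [N HN].
    exists (M + N). intros z hz. rewrite (C_deriv_n_fadd Om) by auto.
    apply Rle_trans with (1 := Cmod_triangle _ _). apply Rplus_le_compat; auto.
- intros c f [f0 [Hf Bf]]. split; [|split].
  + intros z hz. unfold fscal. rewrite f0 by auto. ring.
  + now apply holomorphic_fscal.
  + intros l hl. destruct (Bf l hl) as [M HM].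
    exists (Cmod c * M). intros z hz. rewrite (C_deriv_n_fscal Om) by auto.
    rewrite Cmod_mult. apply Rmult_le_compat_l; auto using Cmod_ge_0.
Qed.

Lemma H_F_infty_fsub Om F f g :
  open_C Om -> H_F_infty Om F f -> H_F_infty Om F g -> H_F_infty Om F (fsub f g).
Proof.
intros hOm Hf Hg. destruct (H_F_infty_subspace Om F hOm) as [_ [hadd hscal]].
rewrite fsub_fadd_fscal. auto.
Qed.

(** Boundedness excludes the supremum [p_infty], whose real value would be 0; [0 <= M] covers empty
    [Om], where the norm is 0. *)
Lemma sup_norm_le_iff Om f M :
  bounded_on Om f -> 0 <= M ->
  (sup_norm Om f <= M <-> forall z, Om z -> Cmod (f z) <= M).
Proof.
intros [B HB] hM. unfold sup_norm.
destruct (Lub_Rbar_correct (fun x => exists z, Om z /\ x = Cmod (f z))) as [H1 H2].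
set (s := Lub_Rbar _) in *.
assert (hsB : Rbar_le s B).
{ apply H2. intros x [z [hz ->]]. simpl. auto. }
split.
- intros h z hz. assert (T := H1 _ (ex_intro _ z (conj hz eq_refl))).
  destruct s; simpl in *; lra.
- intros h.
  assert (T : Rbar_le s M). { apply H2. intros x [z [hz ->]]. simpl. auto. }
  destruct s; simpl in *; lra.
Qed.

Lemma sup_norm_nonneg Om f : bounded_on Om f -> 0 <= sup_norm Om f.
Proof.
intros [B HB]. unfold sup_norm.
destruct (Lub_Rbar_correct (fun x => exists z, Om z /\ x = Cmod (f z))) as [H1 H2].
set (s := Lub_Rbar _) in *.
destruct (classic (exists z, Om z)) as [[z hz] | no].
- assert (T := H1 _ (ex_intro _ z (conj hz eq_refl))). assert (T0 := Cmod_ge_0 (f z)).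
  destruct s; simpl in *; lra.
(* For empty [Om] the supremum is [m_infty], with real value 0. *)
- assert (T : Rbar_le s m_infty). { apply H2. intros x [z [hz _]]. exfalso; eauto. }
  destruct s; simpl in *; try lra; contradiction.
Qed.

(** * The natural seminorms *)

Definition seminorm_order (j : seminorm_index) : nat :=
  match j with SupDeriv l => l | PointDeriv l _ => l end.

(** Both kinds of seminorm are suprema of a derivative of fixed order over a set, all of [Om] or one
    base point, and so can be handled together. *)
Definition seminorm_points (Om : C -> Prop) (z : nat -> C) (j : seminorm_index) : C -> Prop :=
  match j with SupDeriv _ => Om | PointDeriv _ i => eq (z i) end.

Lemma seminorm_points_sub Om F I z j w :
  (forall i, I i -> Om (z i)) -> valid_index F I j -> seminorm_points Om z j w -> Om w.
Proof. intros hz. destruct j; simpl; auto. intros [_ hi] <-. auto. Qed.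

Lemma natural_seminorm_nonneg Om F I z j f :
  valid_index F I j -> H_F_infty Om F f -> 0 <= natural_seminorm Om z j f.
Proof.
intros hj [_ [_ Hf]]. destruct j; simpl in *.
- now apply sup_norm_nonneg, Hf.
- apply Cmod_ge_0.
Qed.

Lemma natural_seminorm_le_iff Om F I z j f M :
  valid_index F I j -> H_F_infty Om F f -> 0 <= M ->
  (natural_seminorm Om z j f <= M <->
   forall w, seminorm_points Om z j w -> Cmod (C_deriv_n f (seminorm_order j) w) <= M).
Proof.
intros hj [_ [_ Hf]] hM. destruct j; simpl in *.
- apply sup_norm_le_iff; auto.
- split; [now intros h w <- | auto].
Qed.

(** One half of homogeneity, read off pointwise; for [c] nonzero the other half is this inequality
    for [/ c] and [fscal c f]. *)
Lemma natural_seminorm_fscal_le Om F I z j c f :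
  open_C Om -> (forall i, I i -> Om (z i)) -> valid_index F I j -> H_F_infty Om F f ->
  natural_seminorm Om z j (fscal c f) <= Cmod c * natural_seminorm Om z j f.
Proof.
intros hOm hz hj Hf.
assert (hp := natural_seminorm_nonneg Om F I z j f hj Hf).
apply (natural_seminorm_le_iff Om F I); auto.
- destruct (H_F_infty_subspace Om F hOm) as [_ [_ hscal]]. auto.
- apply Rmult_le_pos; auto using Cmod_ge_0.
- intros w hw. destruct Hf as [f0 [Hf Bf]].
  rewrite (C_deriv_n_fscal Om) by (auto; now apply (seminorm_points_sub Om F I z j w)).
  rewrite Cmod_mult. apply Rmult_le_compat_l; auto using Cmod_ge_0.
  refine (proj1 (natural_seminorm_le_iff Om F I z j f _ hj _ hp) (Rle_refl _) w hw).
  now split.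
Qed.

Lemma natural_seminorm_is_seminorm Om F I z j :
  open_C Om -> (forall i, I i -> Om (z i)) -> valid_index F I j ->
  is_seminorm_on (H_F_infty Om F) (natural_seminorm Om z j).
Proof.
intros hOm hz hj. destruct (H_F_infty_subspace Om F hOm) as [_ [hadd hscal]].
split; [|split].
- intros f Hf. now apply (natural_seminorm_nonneg Om F I).
- intros c f Hf. apply Rle_antisym; [now apply (natural_seminorm_fscal_le Om F I)|].
  destruct (classic (c = 0%C)) as [-> | hc].
  + rewrite Cmod_0, Rmult_0_l. apply (natural_seminorm_nonneg Om F I); auto.
  + assert (T := natural_seminorm_fscal_le Om F I z j (/ c)%C (fscal c f) hOm hz hj (hscal c f Hf)).
    replace (fscal (/ c)%C (fscal c f)) with f in T.
    2: { apply functional_extensionality. intros x. unfold fscal. field; auto. }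
    rewrite Cmod_inv in T by auto.
    assert (hm : 0 < Cmod c) by now apply Cmod_gt_0.
    apply (Rmult_le_compat_l (Cmod c)) in T; [|lra].
    rewrite <- Rmult_assoc, Rinv_r, Rmult_1_l in T by lra. exact T.
- intros f g Hf Hg.
  assert (pf := natural_seminorm_nonneg Om F I z j f hj Hf).
  assert (pg := natural_seminorm_nonneg Om F I z j g hj Hg).
  apply (natural_seminorm_le_iff Om F I); auto; [lra|].
  intros w hw.
  assert (A := proj1 (natural_seminorm_le_iff Om F I z j f _ hj Hf pf) (Rle_refl _) w hw).
  assert (B := proj1 (natural_seminorm_le_iff Om F I z j g _ hj Hg pg) (Rle_refl _) w hw).
  destruct Hf as [_ [Hf _]], Hg as [_ [Hg _]].
  rewrite (C_deriv_n_fadd Om) by (auto; now apply (seminorm_points_sub Om F I z j w)).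
  apply Rle_trans with (1 := Cmod_triangle _ _). lra.
Qed.

(** * The metric of a sequence of seminorms *)

(** [seminorms_dist] as a function of the sequence of seminorm values, which turns the metric
    estimates into statements about real sequences. *)
Definition weighted_sum (a : nat -> R) : R :=
  Series (fun k => (/ 2) ^ k * (a k / (1 + a k))).

Lemma frac_bounds x : 0 <= x -> 0 <= x / (1 + x) /\ x / (1 + x) <= 1 /\ x / (1 + x) <= x.
Proof.
intros hx. assert (hi : 0 < / (1 + x)) by (apply Rinv_0_lt_compat; lra).
split; [|split].
- apply Rmult_le_pos; lra.
- apply (Rmult_le_reg_r (1 + x)); [lra|]. field_simplify; lra.
- apply (Rmult_le_reg_r (1 + x)); [lra|]. field_simplify; [|lra]. nra.
Qed.

Lemma frac_le x y : 0 <= x -> x <= y -> x / (1 + x) <= y / (1 + y).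
Proof.
intros hx hy. apply (Rmult_le_reg_r ((1 + x) * (1 + y))); [nra|].
field_simplify; [nra | lra | lra].
Qed.

Lemma weighted_sum_ex a :
  (forall k, 0 <= a k) -> ex_series (fun k => (/ 2) ^ k * (a k / (1 + a k))).
Proof.
intros ha. apply (ex_series_le (V := R_CompleteNormedModule)) with (fun k => (/ 2) ^ k).
- intros k. assert (hp : 0 <= (/ 2) ^ k) by (apply pow_le; lra).
  destruct (frac_bounds (a k) (ha k)) as [h1 [h2 _]].
  unfold norm; simpl. unfold abs; simpl. rewrite Rabs_pos_eq; [nra|].
  now apply Rmult_le_pos.
- apply ex_series_geom. rewrite Rabs_pos_eq; lra.
Qed.

Lemma weighted_sum_shift a :
  (forall k, 0 <= a k) ->
  weighted_sum a = a 0%nat / (1 + a 0%nat) + / 2 * weighted_sum (fun k => a (S k)).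
Proof.
intros ha. unfold weighted_sum.
rewrite Series_incr_1 by now apply weighted_sum_ex.
rewrite <- Series_scal_l. f_equal; [simpl; ring|].
apply Series_ext. intros k. simpl. ring.
Qed.

Lemma weighted_sum_le a b :
  (forall k, 0 <= a k <= b k) -> weighted_sum a <= weighted_sum b.
Proof.
intros H. apply Series_le.
- intros k. assert (hp : 0 <= (/ 2) ^ k) by (apply pow_le; lra).
  destruct (H k) as [h1 h2]. split.
  + apply Rmult_le_pos; auto. now apply frac_bounds.
  + apply Rmult_le_compat_l; auto. now apply frac_le.
- apply weighted_sum_ex. intros k. destruct (H k); lra.
Qed.

Lemma weighted_sum_0 a : (forall k, a k = 0) -> weighted_sum a = 0.
Proof.
intros H. unfold weighted_sum.
rewrite (Series_ext _ (fun k => 0 * (/ 2) ^ k)).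
- rewrite Series_scal_l. ring.
- intros k. rewrite H. unfold Rdiv. ring.
Qed.

Lemma weighted_sum_nonneg a : (forall k, 0 <= a k) -> 0 <= weighted_sum a.
Proof.
intros H. apply Rle_trans with (weighted_sum (fun _ => 0)).
- right. symmetry. now apply weighted_sum_0.
- apply weighted_sum_le. intros k. split; auto; lra.
Qed.

(** The function [x / (1 + x)] is increasing and subadditive on nonnegative reals. *)
Lemma weighted_sum_triangle a b c :
  (forall k, 0 <= a k) -> (forall k, 0 <= b k) -> (forall k, 0 <= c k) ->
  (forall k, a k <= b k + c k) -> weighted_sum a <= weighted_sum b + weighted_sum c.
Proof.
intros ha hb hc H. unfold weighted_sum.
rewrite <- Series_plus by now apply weighted_sum_ex.
apply Series_le.
- intros k. assert (hp : 0 <= (/ 2) ^ k) by (apply pow_le; lra).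
  specialize (ha k). specialize (hb k). specialize (hc k). specialize (H k). split.
  + apply Rmult_le_pos; auto. now apply frac_bounds.
  + rewrite <- Rmult_plus_distr_l. apply Rmult_le_compat_l; auto.
    apply Rle_trans with (1 := frac_le _ _ ha H).
    replace ((b k + c k) / (1 + (b k + c k))) with
      (b k * / (1 + (b k + c k)) + c k * / (1 + (b k + c k))) by (field; lra).
    apply Rplus_le_compat; apply Rmult_le_compat_l; auto; apply Rinv_le_contravar; lra.
- apply (ex_series_plus (V := R_NormedModule)); now apply weighted_sum_ex.
Qed.

Lemma weighted_sum_term a k :
  (forall k, 0 <= a k) -> (/ 2) ^ k * (a k / (1 + a k)) <= weighted_sum a.
Proof.
revert a. induction k as [|k IH]; intros a ha; rewrite weighted_sum_shift by auto.
- assert (T := weighted_sum_nonneg (fun k => a (S k)) (fun k => ha (S k))). simpl; lra.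
- specialize (IH (fun k => a (S k)) (fun k => ha (S k))). simpl in *.
  destruct (frac_bounds (a 0%nat) (ha 0%nat)) as [h1 _]. lra.
Qed.

(** The first [K] terms contribute at most [2 * delta], and the tail is dominated by a geometric
    series. *)
Lemma weighted_sum_bound a K delta :
  0 <= delta -> (forall k, 0 <= a k) -> (forall k, (k < K)%nat -> a k <= delta) ->
  weighted_sum a <= 2 * delta + 2 * (/ 2) ^ K.
Proof.
intros hd. revert a. induction K as [|K IH]; intros a ha H.
- apply Rle_trans with (Series (fun k => (/ 2) ^ k)).
  + apply Series_le.
    * intros k. assert (hp : 0 <= (/ 2) ^ k) by (apply pow_le; lra).
      destruct (frac_bounds (a k) (ha k)) as [h1 [h2 _]]. nra.
    * apply ex_series_geom. rewrite Rabs_pos_eq; lra.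
  + rewrite Series_geom by (rewrite Rabs_pos_eq; lra). simpl. lra.
- rewrite weighted_sum_shift by auto.
  specialize (IH (fun k => a (S k)) (fun k => ha (S k)) ltac:(intros; apply H; lia)).
  destruct (frac_bounds (a 0%nat) (ha 0%nat)) as [_ [_ h]].
  specialize (H 0%nat ltac:(lia)). simpl. lra.
Qed.

(** With [delta = eps / 8] and [(1/2)^K] below [eps / 4], the bound is below [3/4 * eps]. Thus
    finitely many small seminorms force a small distance. *)
Lemma weighted_sum_small eps :
  0 < eps -> exists (K : nat) (delta : R), 0 < delta /\
    forall a, (forall k, 0 <= a k) -> (forall k, (k < K)%nat -> a k <= delta) ->
      weighted_sum a < eps.
Proof.
intros heps.
destruct (pow_lt_1_zero (/ 2) ltac:(rewrite Rabs_pos_eq; lra) (eps / 4) ltac:(lra)) as [K HK].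
specialize (HK K (Nat.le_refl K)). rewrite Rabs_pos_eq in HK by (apply pow_le; lra).
exists K, (eps / 8). split; [lra|]. intros a ha H.
assert (T := weighted_sum_bound a K (eps / 8) ltac:(lra) ha H). lra.
Qed.

(** One term is dominated by the sum and [x / (1 + x)] increases, so [eta] is the [k]-th term at
    [a k = eps]. *)
Lemma weighted_sum_control k eps :
  0 < eps -> exists eta, 0 < eta /\
    forall a, (forall k, 0 <= a k) -> weighted_sum a < eta -> a k < eps.
Proof.
intros heps.
assert (hp : 0 < (/ 2) ^ k) by (apply pow_lt; lra).
exists ((/ 2) ^ k * (eps / (1 + eps))). split.
- apply Rmult_lt_0_compat; auto. apply Rdiv_lt_0_compat; lra.
- intros a ha H. apply Rnot_le_lt. intros hle.
  assert (T := weighted_sum_term a k ha).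
  assert (T2 := frac_le eps (a k) ltac:(lra) hle).
  apply (Rmult_le_compat_l ((/ 2) ^ k)) in T2; lra.
Qed.

(** * Separation and completeness *)

Lemma minimum_exists (F : nat -> Prop) : (exists l, F l) -> exists m, is_minimum F m.
Proof.
intros [l hl]. revert hl. induction l as [l IH] using (well_founded_induction Nat.lt_wf_0). intros hl.
destruct (classic (exists k, (k < l)%nat /\ F k)) as [[k [h1 h2]] | no]; [eauto|].
exists l. split; auto. intros k hk. apply Nat.nlt_ge. eauto.
Qed.

Lemma enumerated_component Om I Omi w :
  enumerates_components Om I Omi -> Om w ->
  exists i, I i /\ connected (Omi i) /\ (forall x, Omi i x -> Om x) /\ Omi i w.
Proof.
intros [h1 [_ h3]] hw. destruct (component_exists Om w hw) as [A [hA wA]].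
destruct (h3 A hA) as [i [hi Ai]]. destruct (h1 i hi) as [_ [s [c _]]].
exists i. split; auto. split; auto. split; auto. now apply Ai.
Qed.

(** The sup seminorm of order [min F] starts the argument, the base points carry it down to order 0,
    and Cauchy's estimate then carries it up to every order. *)
Lemma locally_uniformly_cauchy_of_seminorms Om F I Omi z u :
  open_C Om -> (exists l, F l) -> enumerates_components Om I Omi ->
  (forall i, I i -> Omi i (z i)) ->
  (forall n, holomorphic_on Om (u n)) ->
  (forall j, valid_index F I j ->
     uniformly_cauchy (seminorm_points Om z j) (fun n => C_deriv_n (u n) (seminorm_order j))) ->
  forall l, locally_uniformly_cauchy Om (fun n => C_deriv_n (u n) l).
Proof.
intros hOm hF hOmi hz Hu H.
assert (Hul : forall l n, holomorphic_on Om (C_deriv_n (u n) l)).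
{ intros l n. now apply holomorphic_C_deriv_n. }
destruct (minimum_exists F hF) as [m hm].
assert (Hm : locally_uniformly_cauchy Om (fun n => C_deriv_n (u n) m)).
{ intros w hw. destruct (proj1 (open_C_iff Om) hOm w hw) as [r [hr Hr]].
  exists r. split; auto. split; auto.
  apply uniformly_cauchy_sub with (2 := H (SupDeriv m) (proj1 hm)). exact Hr. }
(* Induction on the number [k] of descents from [m]; at order [m - S k], which is below [m], the
   seminorm at the base point of the component is available. *)
assert (down : forall k, (k <= m)%nat ->
  locally_uniformly_cauchy Om (fun n => C_deriv_n (u n) (m - k))).
{ induction k as [|k IH]; intros hk; [now rewrite Nat.sub_0_r|].
  intros w hw.
  destruct (enumerated_component Om I Omi w hOmi hw) as [i [hi [c [s wi]]]].
  apply (locally_uniformly_cauchy_connected Om (Omi i)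
           (fun n => C_deriv_n (u n) (m - S k)) (z i)); auto.
  - specialize (IH ltac:(lia)). replace (m - k)%nat with (S (m - S k)) in IH by lia. exact IH.
  - apply (H (PointDeriv (m - S k) i)). split; auto. exists m. split; auto. lia. }
intros l. induction l as [|l IH].
- specialize (down m (Nat.le_refl m)). rewrite Nat.sub_diag in down. exact down.
- apply (locally_uniformly_cauchy_derive Om (fun n => C_deriv_n (u n) l)); auto.
Qed.

(* The sequence alternating between [f] and [g] is Cauchy for every seminorm. *)
Lemma natural_seminorms_separate Om F I Omi z f g :
  open_C Om -> (exists l, F l) -> enumerates_components Om I Omi ->
  (forall i, I i -> Omi i (z i)) ->
  H_F_infty Om F f -> H_F_infty Om F g ->
  (forall j, valid_index F I j -> natural_seminorm Om z j (fsub f g) <= 0) -> f = g.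
Proof.
intros hOm hF hOmi hz Hf Hg H.
assert (hzO : forall i, I i -> Om (z i)).
{ intros i hi. destruct (proj1 hOmi i hi) as [_ [s _]]. auto. }
assert (Hfg := H_F_infty_fsub Om F f g hOm Hf Hg).
assert (E : forall j, valid_index F I j -> forall w, seminorm_points Om z j w ->
  C_deriv_n f (seminorm_order j) w = C_deriv_n g (seminorm_order j) w).
{ intros j hj w hw.
  assert (T := proj1 (natural_seminorm_le_iff Om F I z j _ 0 hj Hfg (Rle_refl 0)) (H j hj) w hw).
  rewrite (C_deriv_n_fsub Om) in T; [| auto | apply Hf | apply Hg | now apply (seminorm_points_sub Om F I z j w)].
  now apply Cmod_minus_le_0. }
set (u := fun n => if Nat.even n then f else g).
assert (L : locally_uniformly_cauchy Om (fun n => C_deriv_n (u n) 0)).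
{ apply (locally_uniformly_cauchy_of_seminorms Om F I Omi z u); auto.
  - intros n. unfold u. destruct (Nat.even n); [apply Hf | apply Hg].
  - intros j hj eps heps. exists 0%nat. intros n m _ _ w hw.
    assert (Ew := E j hj w hw). unfold u.
    destruct (Nat.even n), (Nat.even m); rewrite ?Ew, Cmod_minus_diag; lra. }
apply functional_extensionality. intros w.
destruct (classic (Om w)) as [hw | hw].
- assert (Hw := locally_uniformly_cauchy_at Om _ w L hw).
  assert (Z : Cmod (f w - g w) <= 0).
  { apply le_epsilon. intros eps heps. destruct (Hw eps heps) as [N HN].
    (* An even and an odd index beyond [N] select [f] and [g]. *)
    specialize (HN (2 * N)%nat (S (2 * N)) ltac:(lia) ltac:(lia) w eq_refl).
    unfold u in HN. rewrite Nat.even_even in HN.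
    rewrite Nat.even_succ, <- Nat.negb_even, Nat.even_even in HN. simpl in HN. lra. }
  now apply Cmod_minus_le_0.
- destruct Hf as [-> _]; auto. destruct Hg as [-> _]; auto.
Qed.

(** By [weierstrass] the limits [L l] of the [l]-th derivatives satisfy [(L l)' = L (S l)], so they
    are the derivatives of [L 0]. The seminorm bounds pass to the limit. *)
Lemma locally_uniform_limit Om F I Omi z u :
  open_C Om -> (exists l, F l) -> enumerates_components Om I Omi ->
  (forall i, I i -> Omi i (z i)) ->
  (forall n, H_F_infty Om F (u n)) ->
  (forall j, valid_index F I j -> forall eps, 0 < eps -> exists N : nat,
     forall n m, (N <= n)%nat -> (N <= m)%nat ->
       natural_seminorm Om z j (fsub (u n) (u m)) <= eps) ->
  exists f, H_F_infty Om F f /\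
    forall j, valid_index F I j -> forall eps, 0 < eps -> exists N : nat,
      forall n, (N <= n)%nat -> natural_seminorm Om z j (fsub (u n) f) <= eps.
Proof.
intros hOm hF hOmi hz Hu H.
assert (hzO : forall i, I i -> Om (z i)).
{ intros i hi. destruct (proj1 hOmi i hi) as [_ [s _]]. auto. }
assert (Hh : forall n, holomorphic_on Om (u n)) by (intros n; apply Hu).
assert (HC : forall j, valid_index F I j ->
     uniformly_cauchy (seminorm_points Om z j) (fun n => C_deriv_n (u n) (seminorm_order j))).
{ intros j hj eps heps. destruct (H j hj eps heps) as [N HN]. exists N.
  intros n m hn hm w hw.
  rewrite <- (C_deriv_n_fsub Om) by (auto; now apply (seminorm_points_sub Om F I z j w)).
  refine (proj1 (natural_seminorm_le_iff Om F I z j _ eps hj _ _) _ w hw); auto; [|lra].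
  now apply H_F_infty_fsub. }
assert (HL := locally_uniformly_cauchy_of_seminorms Om F I Omi z u hOm hF hOmi hz Hh HC).
set (L := fun l w => C_lim_seq (fun n => C_deriv_n (u n) l w)).
assert (DL : forall l w, Om w -> is_C_derive (L l) w (L (S l) w)).
{ intros l w hw. destruct (HL l w hw) as [r [hr [hs Hr]]].
  apply (weierstrass (fun n => C_deriv_n (u n) l) w r); auto.
  intros n. apply holomorphic_sub with (1 := hs). now apply holomorphic_C_deriv_n. }
set (f := fun w => if excluded_middle_informative (Om w) then L 0%nat w else 0%C).
assert (fL : forall l w, Om w -> C_deriv_n f l w = L l w).
{ induction l as [|l IH]; intros w hw.
  - simpl. unfold f. now destruct (excluded_middle_informative (Om w)).
  - apply (C_deriv_n_S_ext Om f (L l)); auto. }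
assert (Vf : H_F_infty Om F f).
{ split; [|split].
  - intros w hw. unfold f. now destruct (excluded_middle_informative (Om w)).
  - intros w hw. exists (L 1%nat w).
    destruct (proj1 (open_C_iff Om) hOm w hw) as [r [hr Hr]].
    apply is_C_derive_ext_disc with (L 0%nat) r; auto.
    intros x hx. symmetry. apply (fL 0%nat). auto.
  (* The [l]-th derivative of the limit stays within 1 of that of one fixed [u N], which is
     bounded. *)
  - intros l hl. destruct (HC (SupDeriv l) hl 1 Rlt_0_1) as [N HN].
    destruct (proj2 (proj2 (Hu N)) l hl) as [M HM].
    exists (M + 1). intros w hw. rewrite fL by auto.
    assert (T := uniformly_cauchy_C_lim _ _ (HC (SupDeriv l) hl) 1 N HN N w (Nat.le_refl N) hw).
    simpl in T. fold (L l w) in T. rewrite Cmod_minus_sym in T.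
    replace (L l w) with (C_deriv_n (u N) l w + (L l w - C_deriv_n (u N) l w))%C by ring.
    apply Rle_trans with (1 := Cmod_triangle _ _). specialize (HM w hw). lra. }
exists f. split; auto. intros j hj eps heps.
destruct (HC j hj eps heps) as [N HN]. exists N. intros n hn.
apply (natural_seminorm_le_iff Om F I); auto; [now apply H_F_infty_fsub | lra |].
intros w hw.
assert (hwO : Om w) by (auto; now apply (seminorm_points_sub Om F I z j w)).
rewrite (C_deriv_n_fsub Om), fL; auto; [|apply Vf].
exact (uniformly_cauchy_C_lim _ _ (HC j hj) eps N HN n w hn hw).
Qed.

(** * Metric, topology and completeness of the space *)

Theorem theorem3p5
  (Om : C -> Prop) (F : nat -> Prop)
  (I : nat -> Prop) (Omi : nat -> C -> Prop) (z : nat -> C)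
  (e : nat -> seminorm_index)
  (hOm : open_C Om)
  (hF : exists l, F l)
  (hI : finite_or_nat I)
  (hOmi : enumerates_components Om I Omi)
  (hz : forall i, I i -> Omi i (z i))
  (he : enumerates_indices (valid_index F I) e) :
  let V := H_F_infty Om F in
  let p := natural_seminorm Om z in
  let d := seminorms_dist (fun k => p (e k)) in
  is_subspace V /\
  (forall j, valid_index F I j -> is_seminorm_on V (p j)) /\
  is_metric_on V d /\
  translation_invariant_on V d /\
  (forall U, seminorm_open V (valid_index F I) p U <-> metric_open V d U) /\
  complete_on V d.
Proof.
intros V p d.
assert (hzO : forall i, I i -> Om (z i)).
{ intros i hi. destruct (proj1 hOmi i hi) as [_ [s _]]. auto. }
destruct he as [he1 he2].
assert (Vsub : is_subspace V) by now apply H_F_infty_subspace.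
assert (sem : forall j, valid_index F I j -> is_seminorm_on V (p j)).
{ intros j hj. now apply (natural_seminorm_is_seminorm Om F I). }
assert (Vm : forall f g, V f -> V g -> V (fsub f g)).
{ intros f g. now apply H_F_infty_fsub. }
assert (dE : forall f g, d f g = weighted_sum (fun k => p (e k) (fsub f g))) by reflexivity.
assert (pos : forall f g, V f -> V g -> forall k, 0 <= p (e k) (fsub f g)).
{ intros f g hf hg k. apply (sem (e k) (he1 k)). auto. }
assert (pE : forall j f g h, h = fadd f g -> valid_index F I j -> V f -> V g -> p j h <= p j f + p j g).
{ intros j f g h -> hj hf hg. now apply (sem j hj). }
assert (psym : forall j f g, valid_index F I j -> V f -> V g -> p j (fsub f g) = p j (fsub g f)).
{ intros j f g hj hf hg.
  replace (fsub f g) with (fscal (-1)%C (fsub g f)).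
  - destruct (sem j hj) as [_ [h _]]. rewrite h by auto.
    replace (Cmod (-1)%C) with 1; [ring|].
    rewrite <- Cmod_m1. f_equal. ring.
  - apply functional_extensionality. intros w. unfold fscal, fsub. ring. }
(* Each seminorm is controlled by the distance, since each index occurs in the enumeration [e]. *)
assert (control : forall j eps, valid_index F I j -> 0 < eps -> exists eta, 0 < eta /\
  forall f g, V f -> V g -> d f g < eta -> p j (fsub f g) < eps).
{ intros j eps hj heps. destruct (he2 j hj) as [k <-].
  destruct (weighted_sum_control k eps heps) as [eta [h1 h2]].
  exists eta. split; auto. intros f g hf hg hd.
  apply (h2 (fun k => p (e k) (fsub f g))); auto. }
split; [|split; [|split; [|split; [|split]]]]; auto.
- split; [|split; [|split]].
  + intros f g hf hg. rewrite dE. apply weighted_sum_nonneg. auto.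
  + intros f g hf hg. split.
    * intros h0. apply (natural_seminorms_separate Om F I Omi z); auto.
      (* Distance 0 is below every [eta], so each seminorm of [f - g] is below every [eps]. *)
      intros j hj. apply le_epsilon. intros eps heps.
      destruct (control j eps hj heps) as [eta [h1 h2]].
      specialize (h2 f g hf hg ltac:(lra)). unfold p in h2. lra.
    * intros <-. rewrite dE. apply weighted_sum_0. intros k.
      replace (fsub f f) with (fscal 0%C f).
      -- destruct (sem _ (he1 k)) as [_ [h _]]. rewrite h, Cmod_0 by auto. ring.
      -- apply functional_extensionality. intros w. unfold fscal, fsub. ring.
  + intros f g hf hg. rewrite !dE. unfold weighted_sum. apply Series_ext. intros k.
    now rewrite psym.
  + intros f g h hf hg hh. rewrite !dE. apply weighted_sum_triangle; auto.
    intros k. apply pE; auto.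
    apply functional_extensionality. intros w. unfold fadd, fsub. ring.
- intros f g h _ _ _. rewrite !dE. unfold weighted_sum. apply Series_ext. intros k.
  replace (fsub (fadd f h) (fadd g h)) with (fsub f g); [reflexivity|].
  apply functional_extensionality. intros w. unfold fadd, fsub. ring.
- intros U. split.
  + intros H f hf hU. destruct (H f hf hU) as [js [eps [hjs Hjs]]].
    (* One [eta] serves the whole finite list, as the minimum of those of its members. *)
    assert (T : exists eta, 0 < eta /\ forall g, V g -> d g f < eta ->
      forall j, In j js -> p j (fsub g f) < eps).
    { clear Hjs. induction js as [|j js IH].
      - exists 1. split; [lra|]. intros g _ _ j [].
      - destruct IH as [eta1 [h1 H1]]; [intros; apply hjs; now right|].
        destruct (control j eps (hjs j (or_introl eq_refl)) (cond_pos eps)) as [eta2 [h2 H2]].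
        exists (Rmin eta1 eta2). split; [now apply Rmin_pos|]. intros g hg hd i [<- | hi].
        + apply H2; auto. apply Rlt_le_trans with (1 := hd). apply Rmin_r.
        + apply H1; auto. apply Rlt_le_trans with (1 := hd). apply Rmin_l. }
    destruct T as [eta [h1 h2]]. exists (mkposreal eta h1). intros g hg hd. auto.
  + intros H f hf hU. destruct (H f hf hU) as [eps Heps].
    destruct (weighted_sum_small eps (cond_pos eps)) as [K [delta [h1 h2]]].
    (* The first [K] seminorms of the enumeration already determine the distance up to [eps]. *)
    exists (map e (seq 0 K)), (mkposreal delta h1). split.
    * intros j hj. apply in_map_iff in hj. destruct hj as [k [<- _]]. auto.
    * intros g hg hs. apply Heps; auto. rewrite dE. apply h2; auto.
      intros k hk. left. apply hs. apply in_map. apply in_seq. lia.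
- intros u Hu Hc.
  destruct (locally_uniform_limit Om F I Omi z u) as [f [Hf Hlim]]; auto.
  { intros j hj eps heps. destruct (control j eps hj heps) as [eta [h1 h2]].
    destruct (Hc (mkposreal eta h1)) as [N HN]. exists N. intros n m hn hm.
    left. apply h2; auto. }
  exists f. split; auto. intros eps.
  destruct (weighted_sum_small eps (cond_pos eps)) as [K [delta [h1 h2]]].
  (* Only [K] seminorms matter, so the maximum of their thresholds suffices. *)
  assert (T : exists N : nat, forall n, (N <= n)%nat -> forall k, (k < K)%nat ->
    p (e k) (fsub (u n) f) <= delta).
  { clear h2. induction K as [|K [N1 IH]].
    - exists 0%nat. intros; lia.
    - destruct (Hlim (e K) (he1 K) delta h1) as [N2 HN2].
      exists (Nat.max N1 N2). intros n hn k hk.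
      destruct (Nat.eq_dec k K) as [-> | hne].
      + apply HN2; lia.
      + apply IH; lia. }
  destruct T as [N HN]. exists N. intros n hn. rewrite dE. apply h2; auto.
Qed.
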